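(* Let $R$ be a standard graded polynomial ring over a field $\mathbb{K}$ and let $u_1,\dots,u_n$ be a homogeneous $d$-sequence in $R$ with $\deg(u_i)=d_i$ such that $u_1,\dots,u_{n-1}$ is a regular sequence. Set $U=(u_1,\dots,u_n)$ and $d=\max\{d_i : 1\leq i\leq n\}$. Then, for all $s\geq 1$, \[\operatorname{reg}(R/U^s)\leq d(s-1)+\max\Bigl\{\operatorname{reg}(R/U),\ \sum_{i=1}^{n-1}d_i-n\Bigr\}.\]
   Context: Homogeneous elements $u_1,\dots,u_n$ of $R$ form a homogeneous $d$-sequence if (1) no $u_i$ lies in the ideal generated by the other $u_j$'s, and (2) for all $i\geq 0$ and all $k\geq i+1$ (with $i+1,k\le n$), $((u_1,\dots,u_i):u_{i+1}u_k)=((u_1,\dots,u_i):u_k)$. $\operatorname{reg}$ denotes Castelnuovo–Mumford regularity, with $\operatorname{reg}(0)=-\infty$. *)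

(* Defs.v *)
From mathcomp Require Import all_boot all_order all_algebra mpoly.
(* Not imported: the notations of classical_sets clash with those of mpoly. *)
From mathcomp Require classical_sets.
From mathcomp Require Import constructive_ereal.

Set Implicit Arguments.
Unset Strict Implicit.
Unset Printing Implicit Defensive.

Import Order.TTheory GRing.Theory Num.Theory.
Local Open Scope ring_scope.

Section Ideals.
Variable A : comNzRingType.

(* The ideal generated by the u j with P j. *)
Definition gen_ideal (n : nat) (P : pred 'I_n) (u : 'I_n -> A) : A -> Prop :=
  fun x => exists c : 'I_n -> A, x = \sum_(j < n | P j) c j * u j.

(* (u_1, ..., u_i); indices are 0-based, so these are the u j with j < i. *)
Definition prefix_ideal (n i : nat) (u : 'I_n -> A) : A -> Prop :=
  gen_ideal [pred j : 'I_n | (j < i)%N] u.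

Definition ideal_mul (I J : A -> Prop) : A -> Prop :=
  fun x => exists (k : nat) (a b : 'I_k -> A),
    [/\ forall l, I (a l), forall l, J (b l) & x = \sum_(l < k) a l * b l].

Fixpoint ideal_pow (I : A -> Prop) (s : nat) : A -> Prop :=
  if s is s'.+1 then ideal_mul (ideal_pow I s') I else fun=> True.

Definition colon (I : A -> Prop) (x : A) : A -> Prop := fun r => I (r * x).

Definition regular_sequence (n : nat) (u : 'I_n -> A) : Prop :=
  (forall (i : 'I_n) (r : A), prefix_ideal i u (r * u i) -> prefix_ideal i u r)
  /\ ~ gen_ideal predT u 1.

(* With 0-based indices, u i below is the u_{i+1} of the usual definition, so
   that k >= i+1 becomes i <= k. *)
Definition d_sequence (n : nat) (u : 'I_n -> A) : Prop :=
  (forall i : 'I_n, ~ gen_ideal (predC1 i) u (u i)) /\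
  (forall i k : 'I_n, (i <= k)%N -> forall r : A,
     colon (prefix_ideal i u) (u i * u k) r <->
     colon (prefix_ideal i u) (u k) r).

End Ideals.

Section Regularity.
Variables (K : fieldType) (m : nat).
Local Notation R := {mpoly K[m]}.

(* R is concentrated in nonnegative degrees. *)
Definition homogeneous (e : int) (p : R) : Prop :=
  match e with
  | Posz e' => p \is e'.-homog
  | Negz _ => p = 0
  end.

(* A sequence of free modules F_i = \bigoplus_k R(- res_deg i k), whose elements
   are row vectors, with maps F_{i+1} -> F_i and a map F_0 -> R/I given by
   representatives in R of the images of the basis of F_0. *)
Record free_chain := FreeChain {
  res_rank : nat -> nat;
  res_deg : forall i, 'I_(res_rank i) -> int;
  res_map : forall i, 'M[R]_(res_rank i.+1, res_rank i);
  res_aug : 'cV[R]_(res_rank 0)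
}.

(* In order: the maps are homogeneous of degree 0, F_0 -> R/I is surjective,
   the sequence is exact at F_0 and at every F_{i+1}, and the image of F_{i+1}
   is contained in (x_1, ..., x_m) F_i.  The last condition for i = 0 makes the
   generators of R/I minimal.  The length is not bounded a priori. *)
Definition minimal_graded_free_resolution (I : R -> Prop) (F : free_chain) :
    Prop :=
  [/\ (forall k, homogeneous (res_deg k) (res_aug F k 0)) /\
      (forall i k l, homogeneous (res_deg k - res_deg l) (res_map F i k l)),
      (forall r : R, exists v : 'rV[R]_(res_rank F 0),
         I (r - (v *m res_aug F) 0 0)),
      (forall v : 'rV[R]_(res_rank F 0),
         I ((v *m res_aug F) 0 0) <-> exists w, v = w *m res_map F 0),
      (forall i (v : 'rV[R]_(res_rank F i.+1)),
         v *m res_map F i = 0 <-> exists w, v = w *m res_map F i.+1) &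
      (forall i k l, (res_map F i k l)@_0%MM = 0)].

(* The j - i such that the graded Betti number beta_{i,j}(R/I) is nonzero, i.e.
   R(-j) is a summand of F_i in a minimal graded free resolution F of R/I. *)
Definition betti_shifts (I : R -> Prop) : \bar int -> Prop :=
  fun x => exists (F : free_chain) (i : nat) (k : 'I_(res_rank F i)),
    minimal_graded_free_resolution I F /\ x = (res_deg k - i%:Z)%:E.

(* reg(R/I).  The supremum of the empty set is -oo, so that reg(0) = -oo; every
   nonempty set in \bar int has a supremum, attained if it is finite. *)
Definition reg_quotient (I : R -> Prop) : \bar int :=
  classical_sets.supremum -oo%E (betti_shifts I).

End Regularity.

(* Main.v *)
(** Castelnuovo-Mumford regularity is handled through the existence of graded
    free covers: R/I has regularity at most r when it is generated in degrees
    <= r, its first syzygies in degrees <= r + 1, and so on.  This notion is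
    subadditive along the exact sequences
      0 -> R/(I : f)(- deg f) -> R/I -> R/(I, f) -> 0,
    and it agrees with the Betti numbers of any minimal graded resolution, one
    of which exists by Hilbert's basis theorem.

    Write J_i = (u_1, ..., u_i), sigma = d_1 + ... + d_(n-1) - (n - 1) = reg R/J_(n-1)
    and M(i, s) = R/(J_i + U^s).  Since J_i cap U^(s+1) = J_i U^s, one has
    (J_i + U^(s+1)) : u_(i+1) = J_i + U^s for i < n - 1, hence
      reg M(i, s+1) <= max (reg M(i, s) + d_(i+1), reg M(i+1, s+1)),
    and everything reduces to M(n-1, s) = R/(J_(n-1), u_n^s).  The d-sequence
    property gives J_(n-1) : u_n^s = J_(n-1) : u_n, so the sequence for f = u_n
    bounds reg R/(J_(n-1) : u_n) + d_n by max (sigma, reg R/U + 1), and then the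
    sequence for f = u_n^s bounds reg M(n-1, s) by
    d_n (s - 1) + max (reg R/U, sigma - 1) for s >= 2. *)

Require Import Defs.
From mathcomp Require Import all_boot all_order all_algebra mpoly.
(* Not imported: the notations of classical_sets clash with those of mpoly. *)
From mathcomp Require classical_sets.
From mathcomp Require Import constructive_ereal boolp ring zify.

Set Implicit Arguments.
Unset Strict Implicit.
Unset Printing Implicit Defensive.

Import Order.TTheory GRing.Theory Num.Theory.
Local Open Scope ring_scope.

(** * Graded free covers *)

Section Graded.
Variables (K : fieldType) (m : nat).
Local Notation R := {mpoly K[m]}.

(** Degrees are integers, so that differences such as [t - e k] need no side condition; negative
    components vanish, in accordance with [homogeneous]. *)
Definition hcomp (t : int) (p : R) : R :=
  if t is Posz a then pihomog mdeg a p else 0.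

Lemma hcompD t : {morph hcomp t : p q / p + q}.
Proof. by case: t => a p q /=; rewrite ?addr0 ?pihomogD. Qed.

Lemma hcomp0 t : hcomp t 0 = 0.
Proof. by case: t => a //=; rewrite pihomog0. Qed.

Lemma hcomp_sum t I (r : seq I) (P : pred I) (F : I -> R) :
  hcomp t (\sum_(i <- r | P i) F i) = \sum_(i <- r | P i) hcomp t (F i).
Proof. exact: (big_morph _ (hcompD t) (hcomp0 t)). Qed.

Lemma homogeneous_hcomp t p : homogeneous t (hcomp t p).
Proof. by case: t => a //=; apply: pihomogP. Qed.

Lemma hcomp_id t (p : R) : homogeneous t p -> hcomp t p = p.
Proof. by case: t => a /= => [/pihomog_dE|->]. Qed.

Lemma hcomp_neq s t (p : R) : homogeneous t p -> s != t -> hcomp s p = 0.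
Proof.
case: s t => [a|a] [b|b] //= hp; last by rewrite hp pihomog0.
by move=> ne; rewrite (pihomog_ne0 _ hp) // eq_sym.
Qed.

Lemma hcomp_partition (p : R) : p = \sum_(i < msize p) hcomp (i : nat) p.
Proof. exact: pihomog_partitionE. Qed.

Lemma homogeneous0 t : homogeneous t (0 : R).
Proof. by case: t => a //=; rewrite dhomog0. Qed.

Lemma homogeneous1 : homogeneous 0 (1 : R).
Proof. exact: dhomog1. Qed.

Lemma homogeneousD t (p q : R) :
  homogeneous t p -> homogeneous t q -> homogeneous t (p + q).
Proof.
case: t => a /=; first exact: dhomogD.
by move=> -> ->; rewrite addr0.
Qed.

Lemma homogeneousN t (p : R) : homogeneous t p -> homogeneous t (- p).
Proof. by case: t => a /=; [rewrite dhomogN | move=> ->; rewrite oppr0]. Qed.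

Lemma homogeneous_coef0 t (p : R) : homogeneous t p -> t != 0 -> p@_0%MM = 0.
Proof.
case: t => a /= => [hp a0|-> _]; last exact: mcoeff0.
by apply: (dhomog_nemf_coeff hp); rewrite /= mdeg0 eq_sym.
Qed.

Lemma homogeneous_sum t I (r : seq I) (P : pred I) (F : I -> R) :
  (forall i, P i -> homogeneous t (F i)) ->
  homogeneous t (\sum_(i <- r | P i) F i).
Proof.
move=> h; elim/big_rec: _ => [|i x Pi hx]; first exact: homogeneous0.
by apply: homogeneousD; first exact: h.
Qed.

Lemma homogeneousM a b (p q : R) :
  homogeneous a p -> homogeneous b q -> homogeneous (a + b) (p * q).
Proof.
case: a => a; last by move=> -> _; rewrite mul0r; apply: homogeneous0.
case: b => b; last by move=> _ ->; rewrite mulr0; apply: homogeneous0.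
exact: dhomogM.
Qed.

(** Among the homogeneous components of [x], only the one of degree [t - a] lands in degree [t]
    after multiplication by [f]. *)
Lemma hcompMr t a (x f : R) :
  homogeneous a f -> hcomp t (x * f) = hcomp (t - a) x * f.
Proof.
move=> hf; rewrite {1 2}(hcomp_partition x) mulr_suml !hcomp_sum mulr_suml.
apply: eq_bigr => i _; have hi := homogeneous_hcomp (i : nat) x.
have [->|ne] := eqVneq t (Posz i + a).
  by rewrite addrK (hcomp_id hi) (hcomp_id (homogeneousM hi hf)).
rewrite (hcomp_neq (homogeneousM hi hf)) // (hcomp_neq hi) ?mul0r //.
by apply: contraNneq ne => <-; rewrite subrK.
Qed.

(** Component of degree [t] in the graded free module whose [k]-th basis vector has degree [e k]. *)
Definition rcomp p (e : 'I_p -> int) (t : int) (v : 'rV[R]_p) : 'rV[R]_p :=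
  \row_k hcomp (t - e k) (v 0 k).

Definition graded_mx q p (f : 'I_q -> int) (e : 'I_p -> int) (g : 'M[R]_(q, p)) :=
  forall k l, homogeneous (f k - e l) (g k l).

Lemma rcompD p (e : 'I_p -> int) t : {morph rcomp e t : u v / u + v}.
Proof. by move=> u v; apply/rowP => k; rewrite !mxE hcompD. Qed.

Lemma rcomp0 p (e : 'I_p -> int) t : rcomp e t 0 = 0.
Proof. by apply/rowP => k; rewrite !mxE hcomp0. Qed.

Lemma rcompN p (e : 'I_p -> int) t v : rcomp e t (- v) = - rcomp e t v.
Proof. by apply/eqP; rewrite -addr_eq0 -rcompD addNr rcomp0. Qed.

Lemma rcomp_mul q p (f : 'I_q -> int) (e : 'I_p -> int) t y (g : 'M[R]_(q, p)) :
  graded_mx f e g -> rcomp e t (y *m g) = rcomp f t y *m g.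
Proof.
move=> hg; apply/rowP => l; rewrite !mxE hcomp_sum; apply: eq_bigr => k _.
by rewrite !mxE (hcompMr _ _ (hg k l)) opprB addrA subrK.
Qed.

Lemma rcomp_row q p (f : 'I_q -> int) (e : 'I_p -> int) (g : 'M[R]_(q, p)) k :
  graded_mx f e g -> rcomp e (f k) (row k g) = row k g.
Proof. by move=> hg; apply/rowP => l; rewrite !mxE hcomp_id. Qed.

Lemma graded_mx_rcomp q p (f : 'I_q -> int) (e : 'I_p -> int)
    (v : 'I_q -> 'rV[R]_p) :
  graded_mx f e (\matrix_k rcomp e (f k) (v k)).
Proof. by move=> k l; rewrite !mxE; apply: homogeneous_hcomp. Qed.

Lemma graded_mxM r q p (h : 'I_r -> int) (f : 'I_q -> int) (e : 'I_p -> int) a b :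
  graded_mx h f a -> graded_mx f e b -> graded_mx h e (a *m b).
Proof.
move=> ha hb k l; rewrite mxE; apply: homogeneous_sum => i _.
have -> : h k - e l = (h k - f i) + (f i - e l) by rewrite addrA subrK.
exact: homogeneousM.
Qed.

Lemma graded_mx1 p (e : 'I_p -> int) : graded_mx e e 1%:M.
Proof.
move=> k l; rewrite mxE; case: eqP => [->|_]; last exact: homogeneous0.
by rewrite subrr; apply: homogeneous1.
Qed.

Lemma graded_mx0 q p (f : 'I_q -> int) (e : 'I_p -> int) :
  graded_mx f e (0 : 'M[R]_(q, p)).
Proof. by move=> k l; rewrite mxE; apply: homogeneous0. Qed.

Lemma graded_mxN q p (f : 'I_q -> int) (e : 'I_p -> int) (g : 'M[R]_(q, p)) :
  graded_mx f e g -> graded_mx f e (- g).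
Proof. by move=> hg k l; rewrite mxE; apply: homogeneousN. Qed.

Definition join_deg p q (e : 'I_p -> int) (f : 'I_q -> int) (k : 'I_(p + q)) : int :=
  match split k with inl i => e i | inr j => f j end.

Lemma graded_col_mx p q r (e : 'I_p -> int) (f : 'I_q -> int) (h : 'I_r -> int) a b :
  graded_mx e h a -> graded_mx f h b -> graded_mx (join_deg e f) h (col_mx a b).
Proof. by move=> ha hb k l; rewrite mxE /join_deg; case: splitP => j _. Qed.

Lemma graded_row_mx p q r (e : 'I_p -> int) (f : 'I_q -> int) (h : 'I_r -> int) a b :
  graded_mx h e a -> graded_mx h f b -> graded_mx h (join_deg e f) (row_mx a b).
Proof. by move=> ha hb k l; rewrite mxE /join_deg; case: splitP => j _. Qed.

(** * Graded submodules of free modules *)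

Definition graded_submod p (e : 'I_p -> int) (N : 'rV[R]_p -> Prop) :=
  [/\ N 0, forall u v, N u -> N v -> N (u + v),
      forall c v, N v -> N (c *: v) & forall t v, N v -> N (rcomp e t v)].

Section Submod.
Variables (p : nat) (e : 'I_p -> int) (N : 'rV[R]_p -> Prop).
Hypothesis hN : graded_submod e N.

Lemma gsub0 : N 0. Proof. by case: hN. Qed.
Lemma gsubD u v : N u -> N v -> N (u + v). Proof. by case: hN => _ h _ _; apply: h. Qed.
Lemma gsubZ c v : N v -> N (c *: v). Proof. by case: hN => _ _ h _; apply: h. Qed.
Lemma gsubN v : N v -> N (- v). Proof. by rewrite -scaleN1r; apply: gsubZ. Qed.
Lemma gsubB u v : N u -> N v -> N (u - v).
Proof. by move=> hu hv; apply: gsubD => //; apply: gsubN. Qed.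
Lemma gsub_comp t v : N v -> N (rcomp e t v). Proof. by case: hN => _ _ _ h; apply: h. Qed.

Lemma gsub_eq u v : N (u - v) -> N u <-> N v.
Proof.
move=> h; split=> h'; last by rewrite -(subrK v u); apply: gsubD.
by have := gsubB h' h; rewrite subKr.
Qed.

Lemma gsub_mulmx q (y : 'rV_q) (g : 'M[R]_(q, p)) :
  (forall k, N (row k g)) -> N (y *m g).
Proof.
move=> h; rewrite mulmx_sum_row; elim/big_rec: _ => [|i x _ hx]; first exact: gsub0.
by apply: gsubD => //; apply: gsubZ.
Qed.
End Submod.

Lemma graded_pre q p (f : 'I_q -> int) (e : 'I_p -> int) (g : 'M[R]_(q, p)) N :
  graded_mx f e g -> graded_submod e N -> graded_submod f (fun y => N (y *m g)).
Proof.
move=> hg hN; split=> [|u v hu hv|c v hv|t v hv].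
- by rewrite mul0mx; apply: gsub0 hN.
- by rewrite mulmxDl; apply: (gsubD hN).
- by rewrite -scalemxAl; apply: (gsubZ hN).
- by rewrite -(rcomp_mul _ _ hg); apply: (gsub_comp hN).
Qed.

Lemma graded_cap p (e : 'I_p -> int) N N' :
  graded_submod e N -> graded_submod e N' -> graded_submod e (fun v => N v /\ N' v).
Proof.
move=> h h'; split=> [|u v [? ?] [? ?]|c v [? ?]|t v [? ?]]; split.
- exact: gsub0 h. - exact: gsub0 h'.
- exact: (gsubD h). - exact: (gsubD h').
- exact: (gsubZ h). - exact: (gsubZ h').
- exact: (gsub_comp h). - exact: (gsub_comp h').
Qed.

Lemma graded_zero p (e : 'I_p -> int) : graded_submod e (fun v => v = 0).
Proof.
split=> // [u v -> ->|c v ->|t v ->]; first by rewrite addr0.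
- by rewrite scaler0.
- by rewrite rcomp0.
Qed.

Lemma graded_full p (e : 'I_p -> int) : graded_submod e (fun _ => True).
Proof. by split. Qed.

Lemma mul_delta_rV q p (g : 'M[R]_(q, p)) k : delta_mx 0 k *m g = row k g :> 'rV_p.
Proof. by rewrite rowE. Qed.

(* [Reg n r e L N]: the graded module L/N is generated in degrees <= r, its
   first syzygies in degrees <= r + 1, and so on for n steps. *)
Fixpoint Reg (n : nat) (r : int) p (e : 'I_p -> int) (L N : 'rV[R]_p -> Prop) : Prop :=
  if n is n'.+1 then
    exists (q : nat) (f : 'I_q -> int) (g : 'M[R]_(q, p)),
      [/\ forall k, f k <= r, graded_mx f e g, forall k, L (row k g),
          forall v, L v -> exists y : 'rV_q, N (v - y *m g) &
          Reg n' (r + 1) f (fun y => N (y *m g)) (fun y => y = 0)]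
  else True.

Lemma RegS n r p (e : 'I_p -> int) L N : Reg n.+1 r e L N ->
  exists (q : nat) (f : 'I_q -> int) (g : 'M[R]_(q, p)),
    [/\ forall k, f k <= r, graded_mx f e g, forall k, L (row k g),
        forall v, L v -> exists y : 'rV_q, N (v - y *m g) &
        Reg n (r + 1) f (fun y => N (y *m g)) (fun y => y = 0)].
Proof. by []. Qed.

Lemma Reg_eq n r p (e : 'I_p -> int) L N L' N' :
  (forall v, L v <-> L' v) -> (forall v, N v <-> N' v) ->
  Reg n r e L N -> Reg n r e L' N'.
Proof.
move=> hL hN; have -> : L = L' by apply: funext => v; apply: propext.
by have -> : N = N' by apply: funext => v; apply: propext.
Qed.

Lemma Reg_le n r r' p (e : 'I_p -> int) L N : r <= r' ->
  Reg n r e L N -> Reg n r' e L N.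
Proof.
elim: n r r' p e L N => //= n IH r r' p e L N le_r [q [f [g [h1 h2 h3 h4 h5]]]].
exists q, f, g; split=> // [k|]; first exact: le_trans (h1 k) le_r.
by apply: IH h5; rewrite lerD2r.
Qed.

Lemma Reg_shift n r a p (e : 'I_p -> int) L N :
  Reg n r e L N -> Reg n (r + a) (fun k => e k + a) L N.
Proof.
elim: n r p e L N => //= n IH r p e L N [q [f [g [h1 h2 h3 h4 h5]]]].
exists q, (fun k => f k + a), g; split=> //.
- by move=> k; rewrite lerD2r.
- by move=> k l; rewrite opprD addrACA subrr addr0.
- by rewrite addrAC; apply: IH.
Qed.

(** * Invariance under isomorphism, and extensions *)

Section Iso.
Variables (n : nat) (r : int) (p p' : nat) (e : 'I_p -> int) (e' : 'I_p' -> int).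
Variables (phi : 'M[R]_(p, p')) (L N : 'rV[R]_p -> Prop) (L' N' : 'rV[R]_p' -> Prop).
Hypotheses (hphi : graded_mx e e' phi) (hL : graded_submod e L)
  (hN' : graded_submod e' N').
Hypothesis LL' : forall v, L v -> L' (v *m phi).
Hypothesis L'L : forall v', L' v' -> exists v, L v /\ N' (v' - v *m phi).
Hypothesis NN' : forall v, L v -> (N v <-> N' (v *m phi)).

(** The hypotheses make [phi] induce an isomorphism L/N -> L'/N' of degree 0. A cover of L/N
    composed with [phi] covers L'/N' and has the same syzygies. *)
Lemma Reg_iso : Reg n r e L N -> Reg n r e' L' N'.
Proof.
case: n => // k [q [f [g [f_r hg gL gen hR]]]].
exists q, f, (g *m phi); split=> //.
- exact: graded_mxM hphi.
- by move=> i; rewrite row_mul; apply: LL'.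
- move=> v' /L'L [v [Lv hv]]; have [y hy] := gen v Lv; exists y.
  have Ly : L (v - y *m g) by apply: (gsubB hL) => //; apply: (gsub_mulmx hL).
  move/(NN' Ly): hy; rewrite mulmxBl mulmxA => /(gsubD hN' hv).
  by rewrite addrA subrK.
- apply: Reg_eq hR => // y; rewrite mulmxA; apply: NN'.
  exact: (gsub_mulmx hL).
Qed.

Lemma Reg_iso_inv : Reg n r e' L' N' -> Reg n r e L N.
Proof.
case: n => // k [q [f [g' [f_r hg' gL' gen hR]]]].
have /choice [w hw] : forall i, exists v, L v /\ N' (row i g' - v *m phi).
  by move=> i; apply: L'L.
(* The lift [w i] need not be homogeneous, but its component of degree [f i] is still a lift modulo
   [N'], as [row i g'] is homogeneous of that degree. *)
pose g := \matrix_i rcomp e (f i) (w i).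
have gL i : L (row i g) by rewrite rowK; apply: (gsub_comp hL); case: (hw i).
have hgg y : N' (y *m g' - y *m g *m phi).
  rewrite -mulmxA -mulmxBr; apply: (gsub_mulmx hN') => i.
  rewrite linearB /= row_mul rowK -(rcomp_row i hg') -(rcomp_mul _ _ hphi).
  by rewrite -rcompN -rcompD; apply: (gsub_comp hN'); case: (hw i).
exists q, f, g; split=> //.
- exact: graded_mx_rcomp.
- move=> v Lv; have [y hy] := gen _ (LL' Lv); exists y.
  apply/NN'; first by apply: (gsubB hL) => //; apply: (gsub_mulmx hL).
  rewrite mulmxBl; have := gsubD hN' hy (hgg y).
  by rewrite addrA subrK.
- apply: Reg_eq hR => // y.
  apply: (iff_trans (gsub_eq hN' (hgg y))); apply: iff_sym.
  exact/NN'/(gsub_mulmx hL).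
Qed.
End Iso.

(** Horseshoe argument: covers of L1/N and L/L1 are joined into a cover of L/N. Its syzygies contain
    [Z1], those supported on the first block, which are the syzygies of L1/N; the quotient by [Z1]
    is the syzygy module of L/L1. Induction applies to this new extension. *)
Lemma Reg_ext n r p (e : 'I_p -> int) L L1 N :
  graded_submod e L -> graded_submod e L1 -> graded_submod e N ->
  (forall v, N v -> L1 v) -> (forall v, L1 v -> L v) ->
  Reg n r e L1 N -> Reg n r e L L1 -> Reg n r e L N.
Proof.
elim: n r p e L L1 N => // n IH r p e L L1 N hL hL1 hN NL1 L1L.
case=> q [f [g [f_r hg gL1 gen hR]]] [q' [f' [g' [f_r' hg' gL gen' hR']]]].
exists (q + q')%N, (join_deg f f'), (col_mx g g'); split.
- by move=> k; rewrite /join_deg; case: splitP.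
- exact: graded_col_mx.
- move=> k; rewrite -[k]splitK; case: split => j /=.
    by rewrite rowKu; apply: L1L.
  by rewrite rowKd.
- move=> v /gen' [y' /gen [y hy]]; exists (row_mx y y').
  by rewrite mul_row_col (addrC (y *m g)) opprD addrA.
have gG : graded_mx (join_deg f f') e (col_mx g g') by apply: graded_col_mx.
have hZ := graded_pre gG hN.
pose pr := col_mx (0 : 'M[R]_(q, q')) 1%:M.
have gpr : graded_mx (join_deg f f') f' pr.
  by apply: graded_col_mx; [apply: graded_mx0 | apply: graded_mx1].
pose Z1 (v : 'rV[R]_(q + q')) := N (v *m col_mx g g') /\ v *m pr = 0.
have gZ1 : graded_submod (join_deg f f') Z1.
  exact: (graded_cap hZ (graded_pre gpr (graded_zero _))).
apply: (IH _ _ _ _ Z1) => //.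
- exact: graded_zero.
- by move=> v ->; split; rewrite mul0mx //; apply: gsub0 hN.
- by move=> v [].
- pose i := row_mx (1%:M : 'M[R]_q) (0 : 'M[R]_(q, q')).
  apply: (@Reg_iso _ _ _ _ _ (join_deg f f') i) hR.
  + by apply: graded_row_mx; [apply: graded_mx1 | apply: graded_mx0].
  + exact: graded_pre hg hN.
  + exact: graded_zero.
  + move=> y hy; rewrite /Z1 -!mulmxA mul_row_col mul1mx mul0mx addr0.
    by rewrite mul_row_col mulmx0 mul0mx addr0 mulmx0.
  + move=> v'; rewrite -[v']hsubmxK; move: (lsubmx v') (rsubmx v') => y y'.
    rewrite /Z1 !mul_row_col mulmx0 mulmx1 add0r => -[hv hy']; exists y.
    rewrite hy' mul0mx addr0 in hv *; split=> //.
    by rewrite mul_mx_row mulmx1 mulmx0 subrr.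
  + move=> v _; rewrite mul_mx_row mulmx1 mulmx0; split=> [->|]; first by rewrite row_mx0.
    by move/(congr1 lsubmx); rewrite row_mxKl linear0.
- apply: (@Reg_iso_inv _ _ _ _ (join_deg f f') f' pr) hR' => //.
  + exact: graded_zero.
  + move=> v; rewrite -(hsubmxK v) !mul_row_col mulmx0 add0r mulmx1 => /NL1 h.
    by have := gsubB hL1 h (gsub_mulmx hL1 (lsubmx v) gL1); rewrite addrC addKr.
  (* A syzygy y' of L/L1 has y' g' in [L1], hence equal to y g modulo [N]; the pair (-y, y') is a
     syzygy of the joined cover above it. *)
  + move=> y' /gen [y hy]; exists (row_mx (- y) y'); split.
      by rewrite mul_row_col mulNmx addrC.
    by rewrite mul_row_col mulmx0 add0r mulmx1 subrr.
  + by move=> v Lv; split=> [[]|].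
Qed.
End Graded.
Arguments graded_zero {K m p} e.
Arguments graded_full {K m p} e.

(** * Exact sequences *)

Section Sequences.
Variables (K : fieldType) (m : nat).
Local Notation R := {mpoly K[m]}.

Lemma Reg_zero n r p (e : 'I_p -> int) (L N : 'rV[R]_p -> Prop) :
  (forall v, L v -> N v) -> Reg n r e L N.
Proof.
elim: n r p e L N => //= n IH r p e L N LN.
exists 0%N, (fun => 0), 0; split=> [[]//|[]//|[]//|v Lv|].
  by exists 0; rewrite mul0mx subr0; apply: LN.
by apply: IH => v _; apply: thinmx0.
Qed.

Lemma Reg_free n r q (f : 'I_q -> int) :
  (forall k, f k <= r) -> Reg n r f (fun _ : 'rV[R]_q => True) (fun v => v = 0).
Proof.
case: n => // n f_r; exists q, f, 1%:M; split=> //.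
- exact: graded_mx1.
- by move=> v _; exists v; rewrite mulmx1 subrr.
- by apply: Reg_zero => v; rewrite mulmx1.
Qed.

Section Quotient.
Variables (n : nat) (r : int) (p : nat) (e : 'I_p -> int).
Variables (L L1 N : 'rV[R]_p -> Prop).
Hypotheses (hL1 : graded_submod e L1) (hN : graded_submod e N).
Hypotheses (NL1 : forall v, N v -> L1 v) (L1L : forall v, L1 v -> L v).

(** A cover of L/N also covers L/L1. Its syzygies over [L1] are an extension of L1/N by its syzygies
    over [N]; hence the bound [r + 1] and one step fewer for L1/N. *)
Lemma Reg_quot :
  Reg n.+1 r e L N -> Reg n (r + 1) e L1 N -> Reg n.+1 r e L L1.
Proof.
case=> q [f [g [f_r hg gL gen hR]]] hA; exists q, f, g; split=> // [v Lv|].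
  by have [y hy] := gen v Lv; exists y; apply: NL1.
apply: (Reg_ext (graded_pre hg hL1) (graded_pre hg hN)) hR _ => //.
- exact: graded_zero.
- by move=> v ->; rewrite mul0mx; apply: gsub0 hN.
- by move=> v /NL1.
- apply: (Reg_iso_inv hg (graded_pre hg hL1) hN) hA => // v L1v.
  have [y hy] := gen v (L1L L1v); exists y; split=> //.
  exact: (proj1 (gsub_eq hL1 (NL1 hy))).
Qed.
End Quotient.

(* The pullback P of L/N -> L/L1 <- F along a free cover F is an extension of
   L/N by the first syzygies of L/L1; as F is free, P = L1/N + F, so that L1/N
   is the cokernel of F -> P. *)
Lemma Reg_sub n r p (e : 'I_p -> int) (L L1 N : 'rV[R]_p -> Prop) :
  graded_submod e L -> graded_submod e L1 -> graded_submod e N ->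
  (forall v, N v -> L1 v) -> (forall v, L1 v -> L v) ->
  Reg n r e L N -> Reg n.+1 (r - 1) e L L1 -> Reg n r e L1 N.
Proof.
case: n => // n hL hL1 hN NL1 L1L hB /RegS [q [f [g [f_r hg gL gen hZ]]]].
rewrite subrK in hZ.
pose d := join_deg e f.
pose pr1 := col_mx (1%:M : 'M[R]_p) (0 : 'M[R]_(q, p)).
pose pr2 := col_mx (0 : 'M[R]_(p, q)) (1%:M : 'M[R]_q).
pose df := col_mx (1%:M : 'M[R]_p) (- g).
have g1 : graded_mx d e pr1.
  by apply: graded_col_mx; [apply: graded_mx1 | apply: graded_mx0].
have g2 : graded_mx d f pr2.
  by apply: graded_col_mx; [apply: graded_mx0 | apply: graded_mx1].
have gd : graded_mx d e df.
  by apply: graded_col_mx; [apply: graded_mx1 | apply: graded_mxN].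
have e1 v y : row_mx v y *m pr1 = v by rewrite mul_row_col mulmx1 mulmx0 addr0.
have e2 v y : row_mx v y *m pr2 = y by rewrite mul_row_col mulmx1 mulmx0 add0r.
have ed v y : row_mx v y *m df = v - y *m g.
  by rewrite mul_row_col mulmx1 mulmxN.
(* For pairs (v, y), [P]/[NP] is the pullback. Inside it, [ZP]/[NP] is the first syzygy module of
   L/L1, with quotient L/N via [pr1]; [FP]/[NP] is the free cover, with quotient L1/N via [df]. *)
pose P (x : 'rV[R]_(p + q)) := L (x *m pr1) /\ L1 (x *m df).
pose NP (x : 'rV[R]_(p + q)) := N (x *m pr1) /\ x *m pr2 = 0.
pose ZP (x : 'rV[R]_(p + q)) := N (x *m pr1) /\ L1 (x *m df).
pose FP (x : 'rV[R]_(p + q)) := N (x *m df).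
have gP : graded_submod d P.
  exact: (graded_cap (graded_pre g1 hL) (graded_pre gd hL1)).
have gNP : graded_submod d NP.
  exact: (graded_cap (graded_pre g1 hN) (graded_pre g2 (graded_zero _))).
have gZP : graded_submod d ZP.
  exact: (graded_cap (graded_pre g1 hN) (graded_pre gd hL1)).
have gFP : graded_submod d FP := graded_pre gd hN.
have NPE v y : NP (row_mx v y) <-> N v /\ y = 0 by rewrite /NP e1 e2.
have yL y : L (y *m g) := gsub_mulmx hL y gL.
have NP_FP x : NP x -> FP x.
  rewrite -[x]hsubmxK => /NPE [h ->]; rewrite /FP ed mul0mx subr0 //.
have FP_P x : FP x -> P x.
  rewrite -[x]hsubmxK /FP /P ed e1 => h; split; last exact: NL1.
    exact: (proj2 (gsub_eq hL (L1L _ (NL1 _ h))) (yL _)).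
have hP : Reg n.+1 r d P NP.
  apply: (Reg_ext gP gZP gNP).
  - move=> x; rewrite -[x]hsubmxK => /NPE [h ->]; rewrite /ZP e1 ed mul0mx subr0.
    by split=> //; apply: NL1.
  - by move=> x [h1 h2]; split=> //; apply/L1L/NL1.
  - apply: (Reg_iso_inv g2 gZP (graded_zero _)) hZ.
    + move=> x; rewrite -[x]hsubmxK /ZP e1 ed e2 => -[/NL1 h1 h2].
      by have := gsubB hL1 h1 h2; rewrite subKr.
    + move=> y hy; exists (row_mx 0 y); rewrite /ZP e1 ed e2 subrr; split=> //.
      by split; [apply: gsub0 hN | rewrite sub0r; apply: (gsubN hL1)].
    + by move=> x [h1 h2]; split=> [[]|h]; last by split.
  - apply: (Reg_iso_inv g1 gP hN) hB.
    + by move=> x [].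
    + move=> v Lv; have [y hy] := gen v Lv; exists (row_mx v y).
      by rewrite /P e1 ed subrr; split=> //; apply: gsub0 hN.
    + by move=> x [h1 h2]; split=> [[]|h]; last by split.
have hF : Reg n (r + 1) d FP NP.
  have f_r1 k : f k <= r + 1 by apply: le_trans (f_r k) _; lia.
  apply: (Reg_iso_inv g2 gFP (graded_zero _)) (Reg_free n f_r1) => //.
  - move=> y _; exists (row_mx (y *m g) y).
    by rewrite /FP ed e2 !subrr; split=> //; apply: gsub0 hN.
  - move=> x; rewrite -[x]hsubmxK /FP ed e2 NPE => h; split=> [[]//|h0].
    by split=> //; move: h; rewrite h0 mul0mx subr0.
apply: (Reg_iso gd gP hN) (Reg_quot gFP gNP NP_FP FP_P hP hF) => //.
- by move=> x [].
- move=> v L1v; exists (row_mx v 0); rewrite /P e1 ed mul0mx subr0 subrr.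
  by split; [split=> //; apply: L1L | apply: gsub0 hN].
Qed.

(** * Syzygies and minimality of an arbitrary cover *)

Section Cover.
Variables (p : nat) (e : 'I_p -> int) (L N : 'rV[R]_p -> Prop).
Hypotheses (hL : graded_submod e L) (hN : graded_submod e N).
Variables (q : nat) (f : 'I_q -> int) (g : 'M[R]_(q, p)).
Hypotheses (hg : graded_mx f e g) (gL : forall k, L (row k g)).
Hypothesis gen : forall v, L v -> exists y : 'rV_q, N (v - y *m g).

(** The cover need not be the one provided by [Reg]: its syzygies are the kernel of a map from a
    free module onto L/N, so [Reg_sub] applies. This takes the place of Schanuel's lemma. *)
Lemma Reg_syz n r : (forall k, f k <= r) -> Reg n.+1 r e L N ->
  Reg n (r + 1) f (fun y => N (y *m g)) (fun y => y = 0).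
Proof.
move=> f_r hR; have f_r1 k : f k <= r + 1 by apply: le_trans (f_r k) _; lia.
apply: (Reg_sub (graded_full f) (graded_pre hg hN)) (Reg_free n f_r1) _ => //.
- exact: graded_zero.
- by move=> v ->; rewrite mul0mx; apply: gsub0 hN.
rewrite addrK; apply: (Reg_iso_inv hg (graded_full f) hN) hR => //.
- by move=> v _; apply: (gsub_mulmx hL).
- by move=> v /gen [y hy]; exists y.
Qed.

(** Nakayama-type argument: generator [k] is written through the cover given by [Reg] and back
    through [g]. By minimality the resulting coefficient of generator [k] has constant term 1, so
    some coefficient [y 0 l] has a nonzero constant term. *)
Lemma Reg_min_deg n r : (forall y, N (y *m g) -> forall k, (y 0 k)@_0%MM = 0) ->
  Reg n.+1 r e L N -> forall k, f k <= r.
Proof.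
move=> hmin [q' [f' [g' [f_r hg' gL' gen' _]]]] k.
have [y0 hy0] := gen' _ (gL k).
pose y := rcomp f' (f k) y0.
have hy : N (row k g - y *m g').
  by rewrite -(rcomp_row k hg) -(rcomp_mul _ _ hg') -rcompN -rcompD; apply: (gsub_comp hN).
have /choice [z hz] : forall l, exists z : 'rV_q, N (row l g' - z *m g).
  by move=> l; apply: gen.
pose Z := \matrix_l z l.
have hZ : N (y *m g' - y *m Z *m g).
  rewrite -mulmxA -mulmxBr; apply: (gsub_mulmx hN) => l.
  by rewrite linearB /= row_mul rowK.
have : N ((delta_mx 0 k - y *m Z) *m g).
  have := gsubD hN hy hZ; rewrite addrA subrK.
  by rewrite mulmxBl mul_delta_rV.
move/hmin => /(_ k); rewrite !mxE !eqxx mcoeffB mcoeff1 eqxx raddf_sum /= => /eqP.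
rewrite subr_eq0 => /eqP h1.
have [l /eqP hl] : exists l, (y 0 l)@_0%MM <> 0.
  apply/existsNP => hall; move: h1; rewrite big1 => [/eqP|l _].
    by rewrite oner_eq0.
  by rewrite rmorphM /= hall mul0r.
(* Entry [l] of [y] is homogeneous of degree [f k - f' l], and a nonzero constant term forces this
   degree to be 0. *)
suff -> : f k = f' l by apply: f_r.
apply/eqP; apply: contraNT hl; rewrite -subr_eq0 => ne; rewrite mxE.
by rewrite (homogeneous_coef0 (homogeneous_hcomp _ _) ne).
Qed.
End Cover.
End Sequences.

(** * Cyclic modules and minimal resolutions *)

Section Ideal.
Variable A : comNzRingType.

Definition is_ideal (I : A -> Prop) :=
  [/\ I 0, forall x y, I x -> I y -> I (x + y) & forall c x, I x -> I (c * x)].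

Definition add_gen (I : A -> Prop) (f : A) : A -> Prop :=
  fun x => exists c, I (x - c * f).

Section Theory.
Variable I : A -> Prop.
Hypothesis hI : is_ideal I.

Lemma is_ideal0 : I 0. Proof. by case: hI. Qed.
Lemma is_idealD x y : I x -> I y -> I (x + y).
Proof. by case: hI => _ h _; apply: h. Qed.
Lemma is_idealMl c x : I x -> I (c * x). Proof. by case: hI => _ _ h; apply: h. Qed.
Lemma is_idealMr c x : I x -> I (x * c). Proof. by rewrite mulrC; apply: is_idealMl. Qed.
Lemma is_idealN x : I x -> I (- x). Proof. by rewrite -mulN1r; apply: is_idealMl. Qed.
Lemma is_idealB x y : I x -> I y -> I (x - y).
Proof. by move=> hx hy; apply: is_idealD => //; apply: is_idealN. Qed.
Lemma ideal_sum J (r : seq J) (P : pred J) (F : J -> A) :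
  (forall i, P i -> I (F i)) -> I (\sum_(i <- r | P i) F i).
Proof.
move=> h; elim/big_rec: _ => [|i x Pi hx]; first exact: is_ideal0.
by apply: is_idealD; first exact: h.
Qed.

Lemma colon_ideal f : is_ideal (colon I f).
Proof.
split=> [|x y|c x]; rewrite /colon; first by rewrite mul0r; apply: is_ideal0.
- by rewrite mulrDl; apply: is_idealD.
- by rewrite -mulrA; apply: is_idealMl.
Qed.

Lemma add_gen_ideal f : is_ideal (add_gen I f).
Proof.
split=> [|x y [c hc] [c' hc']|b x [c hc]].
- by exists 0; rewrite mul0r subr0; apply: is_ideal0.
- by exists (c + c'); rewrite mulrDl opprD addrACA; apply: is_idealD.
- by exists (b * c); rewrite -mulrA -mulrBr; apply: is_idealMl.
Qed.

Lemma add_gen_sub f x : I x -> add_gen I f x.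
Proof. by exists 0; rewrite mul0r subr0. Qed.
End Theory.
End Ideal.

Section Cyclic.
Variables (K : fieldType) (m : nat).
Local Notation R := {mpoly K[m]}.

Definition graded_ideal (I : R -> Prop) :=
  is_ideal I /\ forall t x, I x -> I (hcomp t x).

Lemma graded_add_gen (I : R -> Prop) (a : int) f :
  graded_ideal I -> homogeneous a f -> graded_ideal (add_gen I f).
Proof.
move=> [hI gI] hf; split=> [|t x [c hc]]; first exact: add_gen_ideal.
exists (hcomp (t - a) c); rewrite -(hcompMr _ _ hf).
have -> : hcomp t x - hcomp t (c * f) = hcomp t (x - c * f).
  by apply/eqP; rewrite subr_eq -hcompD subrK.
exact: gI.
Qed.

Definition row_ideal (I : R -> Prop) (v : 'rV[R]_1) : Prop := I (v 0 0).

Definition deg0 (k : 'I_1) : int := 0.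

Lemma graded_row_ideal (I : R -> Prop) a :
  graded_ideal I -> graded_submod (fun _ => a) (row_ideal I).
Proof.
move=> [hI gI]; split=> [|u v hu hv|c v hv|t v hv]; rewrite /row_ideal mxE.
- exact: is_ideal0.
- exact: is_idealD.
- exact: is_idealMl.
- exact: gI.
Qed.

(* [reg_le I r] is reg(R/I) <= r. *)
Definition reg_le (I : R -> Prop) (r : int) : Prop :=
  forall n, Reg n r deg0 (fun _ => True) (row_ideal I).

Lemma reg_le_eq (I J : R -> Prop) r :
  (forall x, I x <-> J x) -> reg_le I r -> reg_le J r.
Proof. by move=> h hI n; apply: Reg_eq (hI n) => // v; apply: h. Qed.

Lemma reg_le_trans (I : R -> Prop) r r' : r <= r' -> reg_le I r -> reg_le I r'.
Proof. by move=> h hI n; apply: Reg_le (hI n). Qed.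

Lemma reg_le_unit (I : R -> Prop) r : (forall x, I x) -> reg_le I r.
Proof. by move=> h n; apply: Reg_zero => v _; apply: h. Qed.

Section ExactSequence.
(* 0 -> R/(I : f)(-a) -> R/I -> R/(I, f) -> 0 *)
Variables (I : R -> Prop) (a : int) (f : R).
Hypotheses (hI : graded_ideal I) (hf : homogeneous a f).

Let g1 := graded_row_ideal 0 (graded_add_gen hI hf).
Let g2 := graded_row_ideal 0 hI.
Let sub v : row_ideal I v -> row_ideal (add_gen I f) v.
Proof. exact: add_gen_sub. Qed.

(** Multiplication by [f] is an isomorphism from R/(I : f)(-a) onto (I, f)/I; the twist accounts for
    [r - a]. *)
Lemma Reg_colon n r :
  Reg n r deg0 (row_ideal (add_gen I f)) (row_ideal I) <->
  Reg n (r - a) deg0 (fun _ => True) (row_ideal (colon I f)).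
Proof.
have gphi : graded_mx (fun k => deg0 k + a) deg0 (f%:M : 'M[R]_1).
  by move=> k l; rewrite !ord1 !mxE eqxx mulr1n /deg0 add0r subr0.
have vf (v : 'rV[R]_1) : (v *m f%:M) 0 0 = v 0 0 * f.
  by rewrite mul_mx_scalar mxE mulrC.
have h1 (v : 'rV[R]_1) : True -> row_ideal (add_gen I f) (v *m f%:M).
  by move=> _; exists (v 0 0); rewrite vf subrr; apply: is_ideal0; case: hI.
have h2 (v' : 'rV[R]_1) : row_ideal (add_gen I f) v' ->
    exists v, True /\ row_ideal I (v' - v *m f%:M).
  move=> [c hc]; exists c%:M; split=> //.
  by rewrite /row_ideal !mxE big_ord1 !mxE !eqxx !mulr1n.
have h3 (v : 'rV[R]_1) : True -> row_ideal (colon I f) v <-> row_ideal I (v *m f%:M).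
  by move=> _; rewrite /row_ideal vf.
split=> h; last first.
  rewrite -(subrK a r).
  exact: (Reg_iso gphi (graded_full _) g2 h1 h2 h3 (Reg_shift a h)).
have := Reg_shift (- a) (Reg_iso_inv gphi (graded_full _) g2 h1 h2 h3 h).
by congr Reg; apply: funext => k; rewrite addrK.
Qed.

Lemma reg_le_ext r : reg_le (colon I f) (r - a) -> reg_le (add_gen I f) r -> reg_le I r.
Proof.
move=> h1 h2 n; apply: (Reg_ext (graded_full _) g1 g2) (h2 n) => //.
exact/Reg_colon.
Qed.

Lemma reg_le_quot r :
  reg_le I r -> reg_le (colon I f) (r + 1 - a) -> reg_le (add_gen I f) r.
Proof.
move=> h1 h2 [|n] //; apply: (Reg_quot g1 g2) (h1 n.+1) _ => //.
exact/Reg_colon.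
Qed.

Lemma reg_le_colon r :
  reg_le I r -> reg_le (add_gen I f) (r - 1) -> reg_le (colon I f) (r - a).
Proof.
move=> h1 h2 n; apply/Reg_colon.
exact: (Reg_sub (graded_full _) g1 g2 sub _ (h1 n) (h2 n.+1)).
Qed.
End ExactSequence.

(** * Comparison of [reg_le] with the degrees of a minimal resolution *)

Section Resolution.
Variables (I : R -> Prop) (F : free_chain K m).
Hypotheses (hI : graded_ideal I) (hF : minimal_graded_free_resolution I F).

Let im i (v : 'rV[R]_(res_rank F i)) := exists w, v = w *m res_map F i.

Let aug_graded : graded_mx (@res_deg _ _ F 0) deg0 (res_aug F).
Proof. by case: hF => -[h _] _ _ _ _ k l; rewrite ord1 subr0. Qed.

Let map_graded i : graded_mx (@res_deg _ _ F i.+1) (@res_deg _ _ F i) (res_map F i).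
Proof. by case: hF => -[_ h] _ _ _ _ k l; apply: h. Qed.

Let aug_gen v : True -> exists y, row_ideal I (v - y *m res_aug F).
Proof.
case: hF => _ h _ _ _ _; have [y hy] := h (v 0 0).
by exists y; rewrite /row_ideal !mxE; rewrite mxE in hy.
Qed.

Let aug_ker v : row_ideal I (v *m res_aug F) <-> im v.
Proof. by case: hF => _ _ h _ _; apply: h. Qed.

Let map_ker i (v : 'rV_(res_rank F i.+1)) : v *m res_map F i = 0 <-> im v.
Proof. by case: hF => _ _ _ h _; apply: h. Qed.

Let im_graded i : graded_submod (@res_deg _ _ F i) (@im i).
Proof.
split=> [|u v [w ->] [w' ->]|c v [w ->]|t v [w ->]].
- by exists 0; rewrite mul0mx.
- by exists (w + w'); rewrite mulmxDl.
- by exists (c *: w); rewrite scalemxAl.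
- by eexists; rewrite (rcomp_mul _ _ (@map_graded i)).
Qed.

Let im_min i (v : 'rV_(res_rank F i)) : im v -> forall k, (v 0 k)@_0%MM = 0.
Proof.
move=> [w ->] k; rewrite mxE raddf_sum big1 // => l _ /=.
by rewrite rmorphM /=; case: hF => _ _ _ _ ->; rewrite mulr0.
Qed.

Let im_row i k : im (row k (res_map F i)).
Proof. by exists (delta_mx 0 k); rewrite -rowE. Qed.

Let im_gen i v : im v -> exists y, v - y *m res_map F i = 0.
Proof. by move=> [w ->]; exists w; rewrite subrr. Qed.

(** The proof walks along the resolution: [Reg_min_deg] bounds the degrees of F_i, and then
    [Reg_syz] passes the regularity bound, raised by 1, to the image of F_(i+1) in F_i. *)
Lemma min_res_deg r : reg_le I r ->
  forall i (k : 'I_(res_rank F i)), res_deg k <= r + i%:Z.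
Proof.
move=> hr i; suff [] : (forall k : 'I_(res_rank F i), res_deg k <= r + i%:Z) /\
    forall n, Reg n (r + i%:Z + 1) (@res_deg _ _ F i) (@im i) (fun v => v = 0) by [].
elim: i => [|i [IHdeg IHreg]].
  rewrite addr0; have hN := graded_row_ideal 0 hI.
  have hdeg (k : 'I_(res_rank F 0)) : res_deg k <= r.
    apply: (Reg_min_deg hN aug_graded _ aug_gen _ (hr 1%N)) => //.
    by move=> v /aug_ker; apply: im_min.
  split=> // n.
  have := Reg_syz (graded_full _) hN aug_graded (fun=> Logic.I) aug_gen hdeg (hr n.+1).
  exact: Reg_eq.
have -> : r + i.+1%:Z = r + i%:Z + 1 by rewrite -addn1 PoszD addrA.
have hdeg (k : 'I_(res_rank F i.+1)) : res_deg k <= r + i%:Z + 1.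
  have hmin (v : 'rV_(res_rank F i.+1)) :
      v *m res_map F i = 0 -> forall l, (v 0 l)@_0%MM = 0.
    by move=> /map_ker; apply: im_min.
  exact: (Reg_min_deg (graded_zero _) (@map_graded i) (@im_row i) (@im_gen i) hmin
            (IHreg 1%N)).
split=> // n; have := Reg_syz (@im_graded i) (graded_zero _) (@map_graded i)
  (@im_row i) (@im_gen i) hdeg (IHreg n.+1).
exact: Reg_eq.
Qed.

(** The maps of the resolution themselves serve as the covers required by [Reg]. *)
Lemma min_res_reg r :
  (forall i (k : 'I_(res_rank F i)), res_deg k <= r + i%:Z) -> reg_le I r.
Proof.
move=> hdeg.
have him n : forall i, Reg n (r + i%:Z + 1) (@res_deg _ _ F i) (@im i) (fun v => v = 0).
  elim: n => // n IH i.
  have ri : r + i.+1%:Z = r + i%:Z + 1 by rewrite -addn1 PoszD addrA.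
  exists (res_rank F i.+1), (@res_deg _ _ F i.+1), (res_map F i); split=> //.
  - by move=> k; rewrite -ri; apply: hdeg.
  - exact: im_gen.
  - by have := IH i.+1; rewrite ri; apply: Reg_eq => // v; apply: iff_sym.
case=> // n; exists (res_rank F 0), (@res_deg _ _ F 0), (res_aug F); split=> //.
- by move=> k; have := hdeg 0%N k; rewrite addr0.
- by have := him n 0%N; rewrite addr0; apply: Reg_eq => // v; apply: iff_sym.
Qed.
End Resolution.
End Cyclic.

(** * Hilbert's basis theorem *)

Lemma increasing_ltn (phi : nat -> nat) :
  (forall i, (phi i < phi i.+1)%N) -> forall i j, (i < j)%N -> (phi i < phi j)%N.
Proof. by move=> h; apply: (homo_ltn ltn_trans). Qed.

(** Here [next n] minimizes [b] over the indices beyond [n]. Every term of the subsequence is such a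
    minimizer, so no later value is smaller. *)
Lemma nat_nondecreasing_subseq (b : nat -> nat) : exists phi : nat -> nat,
  (forall i, (phi i < phi i.+1)%N) /\ (forall i, (b (phi i) <= b (phi i.+1))%N).
Proof.
have /choice [next hnext] n : exists j, (n < j)%N /\ forall k, (n < k)%N -> (b j <= b k)%N.
  have ex : exists v, `[< exists2 j, (n < j)%N & b j = v >].
    by exists (b n.+1); apply/asboolP; exists n.+1.
  case: (ex_minnP ex) => v /asboolP [j nj <-] vmin; exists j; split=> // k nk.
  by apply: vmin; apply/asboolP; exists k.
pose phi i := iter i next (next 0%N); exists phi; split=> i.
  by rewrite /phi iterS; case: (hnext (iter i next (next 0%N))).
have [n e] : exists n, phi i = next n.
  by case: i => [|i]; [exists 0%N | exists (phi i)].
have [n_lt n_le] := hnext n; have [lt' _] := hnext (next n).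
have -> : phi i.+1 = next (next n) by rewrite -e.
by rewrite e; apply: n_le; apply: ltn_trans lt'.
Qed.

(** Subsequences are extracted for one coordinate after the other; the first two terms of the last
    one are comparable. *)
Lemma dickson m (a : nat -> 'X_{1..m}) : exists i j, (i < j)%N /\ (a i <= a j)%MM.
Proof.
have [phi [phi_inc phi_le]] : exists phi : nat -> nat,
    (forall i, (phi i < phi i.+1)%N) /\
    forall k, k \in enum 'I_m -> forall i, (a (phi i) k <= a (phi i.+1) k)%N.
  elim: (enum 'I_m) => [|k s [phi [phi_inc phi_le]]]; first by exists id.
  have [psi [psi_inc psi_le]] := nat_nondecreasing_subseq (fun i => a (phi i) k).
  exists (phi \o psi); split=> [i|l].
    exact: (increasing_ltn phi_inc).
  rewrite inE => /orP [/eqP -> //|ls] i /=.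
  apply: (@homo_leq _ (fun i => a (phi i) l) leq) (ltnW (psi_inc i)) => //.
    exact: leq_trans.
  exact: phi_le.
exists (phi 0%N), (phi 1%N); split=> //; apply/mnm_lepP => k.
by apply: phi_le; rewrite mem_enum.
Qed.

Section Hilbert.
Variables (K : fieldType) (m : nat).
Local Notation R := {mpoly K[m]}.

(** The intersection of all ideals containing [s], which avoids coefficients. *)
Definition ideal_span (s : seq R) (x : R) :=
  forall P : R -> Prop, is_ideal P -> (forall y, y \in s -> P y) -> P x.

Lemma ideal_span_ideal s : is_ideal (ideal_span s).
Proof.
split=> [P hP _|x y hx hy P hP hs|c x hx P hP hs]; first exact: is_ideal0.
- by apply: is_idealD => //; [apply: hx | apply: hy].
- by apply: is_idealMl => //; apply: hx.
Qed.

(** One division step. The case [x = c * y] is separate because [mlead 0] is not strictly below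
    [mlead x] when [x] is constant. *)
Lemma mlead_cancel (x y : R) : y != 0 -> (mlead y <= mlead x)%MM ->
  exists c, x = c * y \/ (mlead (x - c * y) < mlead x)%O.
Proof.
move=> y0 le_yx; pose t := 'X_[mlead x - mlead y] : R.
have t0 : t != 0 by rewrite -msupp_eq0 msuppX.
pose c := (mleadc x / mleadc y) *: t; exists c.
have lty : mlead (t * y) = mlead x by rewrite mleadM // mleadXm submK.
have lety : mleadc (t * y) = mleadc y.
  by rewrite mleadM // mleadcM mleadXm mcoeffX eqxx mul1r.
have le_c : (mlead (c * y) <= mlead x)%O.
  by rewrite -scalerAl (le_trans (mleadZ_le _ _)) // lty.
have cx : (x - c * y)@_(mlead x) = 0.
  rewrite mcoeffB -scalerAl mcoeffZ -[in X in _ * X]lty lety divfK ?subrr //.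
  by rewrite mleadc_eq0.
have [/eqP|ne] := eqVneq (x - c * y) 0; first by rewrite subr_eq0 => /eqP; left.
right; rewrite lt_neqAle; apply/andP; split.
  by apply: contraNneq ne => e; rewrite -mleadc_eq0 e cx.
by apply: le_trans (mleadB_le _ _) _; rewrite leUx lexx le_c.
Qed.

(** If no finite list generates, one keeps adjoining an element of [I] outside the span with least
    leading monomial. By [dickson] some leading monomial divides a later one; cancelling it leaves a
    smaller element of [I], which lies in the span by minimality, a contradiction. *)
Lemma hilbert_basis (I : R -> Prop) : is_ideal I ->
  exists s : seq R, (forall y, y \in s -> I y) /\ forall x, I x -> ideal_span s x.
Proof.
move=> hI; apply: contrapT => /forallNP hno.
have /choice [X hX] : forall s : seq R, exists x, (forall y, y \in s -> I y) ->
    [/\ I x, ~ ideal_span s x &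
        forall y, I y -> (mlead y < mlead x)%O -> ideal_span s y].
  move=> s; have [hs|ns] := pselect (forall y, y \in s -> I y); last by exists 0.
  (* If no such element existed, induction on the leading monomial would put all of [I] into the
     span of [s]. *)
  apply: contrapT => /forallNP hx; apply: (hno s); split=> // x Ix.
  move: {2}(mlead x) (erefl (mlead x)) => t; elim/(@ltmwf m): t x Ix => t IH x Ix xt.
  apply: contrapT => hnx; apply: (hx x) => _; split=> // y Iy yx.
  by apply: (IH (mlead y)); rewrite -?xt.
pose s n := iter n (fun s => X s :: s) [::].
have sI n y : y \in s n -> I y.
  elim: n y => // n IH y; rewrite inE => /orP [/eqP ->|]; last exact: IH.
  by have [] := hX _ IH.
have sX i j : (i < j)%N -> X (s i) \in s j.
  elim: j => // j IH; rewrite ltnS leq_eqVlt => /orP [/eqP ->|/IH h].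
    by rewrite inE eqxx.
  by rewrite inE h orbT.
have [i [j [ij le_ij]]] := dickson (fun n => mlead (X (s n))).
have [Ij nj minj] := hX _ (sI j); have [Ii ni _] := hX _ (sI i).
have Xi : X (s i) != 0.
  by apply: contra_notN ni => /eqP ->; apply: is_ideal0; apply: ideal_span_ideal.
have hspan c : ideal_span (s j) (c * X (s i)).
  by apply: (is_idealMl (ideal_span_ideal _)) => P _; apply; apply: sX.
have [c [e|lt]] := mlead_cancel Xi le_ij; apply: nj; first by rewrite e.
rewrite -(subrK (c * X (s i)) (X (s j))).
apply: (is_idealD (ideal_span_ideal _)) => //; apply: minj lt.
by apply: (is_idealB hI) => //; apply: (is_idealMl hI).
Qed.

(** * Finite generation of submodules of free modules *)

Definition is_submod p (N : 'rV[R]_p -> Prop) :=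
  [/\ N 0, forall u v, N u -> N v -> N (u + v) & forall c v, N v -> N (c *: v)].

Lemma submodB p (N : 'rV[R]_p -> Prop) u v : is_submod N -> N u -> N v -> N (u - v).
Proof. by move=> [h0 hD hZ] hu hv; apply: hD => //; rewrite -scaleN1r; apply: hZ. Qed.

(** Induction on the rank: lifts of generators of the ideal [J] of first coordinates are put
    together with generators of the vectors of [N] whose first coordinate is zero. *)
Lemma submod_fg p (N : 'rV[R]_p -> Prop) : is_submod N ->
  exists s : seq 'rV[R]_p, (forall y, y \in s -> N y) /\
    forall P, is_submod P -> (forall y, y \in s -> P y) -> forall v, N v -> P v.
Proof.
elim: p N => [|p IH] N hN.
  by exists [::]; split=> // P [h0 _ _] _ v _; rewrite (thinmx0 v).
have [N0 ND NZ] := hN.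
pose J x := exists v : 'rV[R]_(1 + p), N v /\ v 0 0 = x.
have hJ : is_ideal J.
  split=> [|x y [v [hv <-]] [w [hw <-]]|c x [v [hv <-]]].
  - by exists 0; rewrite mxE.
  - by exists (v + w); rewrite mxE; split=> //; apply: ND.
  - by exists (c *: v); rewrite mxE; split=> //; apply: NZ.
have [s [sJ sgen]] := hilbert_basis hJ.
have /choice [l hl] : forall x, exists v : 'rV[R]_(1 + p), J x -> N v /\ v 0 0 = x.
  by move=> x; have [[v hv]|nJ] := pselect (J x); [exists v | exists 0].
pose i (w : 'rV[R]_p) : 'rV[R]_(1 + p) := row_mx 0 w.
have iD w w' : i (w + w') = i w + i w' by rewrite /i add_row_mx addr0.
have iZ c w : i (c *: w) = c *: i w by rewrite /i scale_row_mx scaler0.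
have i0 : i 0 = 0 by rewrite /i row_mx0.
have sub_i P : is_submod P -> is_submod (P \o i).
  move=> [P0 PD PZ]; split=> [|u v hu hv|c v hv] /=; first by rewrite i0.
  - by rewrite iD; apply: PD.
  - by rewrite iZ; apply: PZ.
have [s' [s'N s'gen]] := IH _ (sub_i _ hN).
exists (map l s ++ map i s'); split=> [y|P hP hs v Nv].
  rewrite mem_cat => /orP [] /mapP [x xs ->]; last exact: s'N.
  by case: (hl x (sJ _ xs)).
have [P0 PD PZ] := hP.
(* Having [u] in [N] as well makes [v - u] an element of [N] with first coordinate zero. *)
have [u [Pu Nu uv]] : exists u, [/\ P u, N u & u 0 0 = v 0 0].
  have Jv : J (v 0 0) by exists v.
  apply: (sgen _ Jv (fun x => exists u, [/\ P u, N u & u 0 0 = x])).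
    split=> [|x y [a [Pa Na <-]] [b [Pb Nb <-]]|c x [a [Pa Na <-]]].
    - by exists 0; rewrite mxE.
    - by exists (a + b); rewrite mxE; split; [apply: PD | apply: ND |].
    - by exists (c *: a); rewrite mxE; split; [apply: PZ | apply: NZ |].
  move=> x xs; exists (l x); have [] := hl x (sJ _ xs); split=> //.
  by apply: hs; rewrite mem_cat map_f.
have e : v - u = i (rsubmx (v - u : 'rV_(1 + p))).
  have l0 : lsubmx (v - u : 'rV_(1 + p)) = 0.
    apply/rowP => k; rewrite !mxE ord1; set z := lshift _ _.
    by have -> : z = 0; [apply: val_inj | rewrite uv subrr].
  by rewrite /i -l0 hsubmxK.
rewrite -(subrK u v); apply: PD => //; rewrite e.
apply: (s'gen _ (sub_i _ hP)) => [y ys|/=].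
  by apply: hs; rewrite mem_cat map_f ?orbT.
by rewrite -e; apply: submodB.
Qed.
End Hilbert.

(** * Existence of minimal graded resolutions *)

Section Existence.
Variables (K : fieldType) (m : nat).
Local Notation R := {mpoly K[m]}.

Lemma hcomp_sum_seq (T : seq int) (b : int) (x : R) :
  uniq T -> (forall i, (i < msize x)%N -> b + i%:Z \in T) ->
  x = \sum_(t <- T) hcomp (t - b) x.
Proof.
move=> uT hT; rewrite {1}[x]hcomp_partition.
under [in RHS]eq_bigr => t _ do rewrite {1}[x]hcomp_partition hcomp_sum.
rewrite exchange_big; apply: eq_bigr => i _ /=.
have hi := homogeneous_hcomp (i : nat) x.
rewrite (bigD1_seq (b + (i : nat)%:Z)) ?hT //= big1 => [|t ne].
  by rewrite addr0 addrC addKr hcomp_id.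
by rewrite (hcomp_neq hi) // subr_eq addrC.
Qed.

Lemma rcomp_partition p (e : 'I_p -> int) (v : 'rV[R]_p) :
  exists T : seq int, v = \sum_(t <- T) rcomp e t v.
Proof.
(* One list of degrees has to serve all entries; [undup] keeps a component from being counted
   twice. *)
exists (undup [seq e k + i%:Z | k <- enum 'I_p, i <- iota 0 (msize (v 0 k))]).
apply/rowP => k; rewrite summxE; under eq_bigr => t _ do rewrite mxE.
apply: hcomp_sum_seq => [|i hi]; first exact: undup_uniq.
rewrite mem_undup; apply/allpairsPdep; exists k, i.
by rewrite mem_enum mem_iota.
Qed.

(** The homogeneous components of finitely many generators stay in [N] and still generate it; [S]
    lists the pairs of a degree and a generator. *)
Lemma graded_fg p (e : 'I_p -> int) (N : 'rV[R]_p -> Prop) : graded_submod e N ->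
  exists q (f : 'I_q -> int) (g : 'M[R]_(q, p)),
    [/\ graded_mx f e g, forall k, N (row k g) & forall v, N v -> exists y, v = y *m g].
Proof.
move=> hN; have sN : is_submod N by case: hN.
have [s [s_N sgen]] := submod_fg sN.
have /choice [T hT] := rcomp_partition e.
pose S := [seq (t, x) | x <- s, t <- T x].
pose f (k : 'I_(size S)) := (nth (0, 0) S k).1.
pose w (k : 'I_(size S)) := (nth (0, 0) S k).2.
exists (size S), f, (\matrix_k rcomp e (f k) (w k)); split.
- exact: graded_mx_rcomp.
- move=> k; rewrite rowK; apply: (gsub_comp hN); apply: s_N.
  have /allpairsPdep [x [t [xs _ e']]] := mem_nth (0, 0) (ltn_ord k).
  by rewrite /w e'.
- move=> v Nv; pose P (v : 'rV[R]_p) := exists y, v = y *m \matrix_k rcomp e (f k) (w k).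
  have PD a b : P a -> P b -> P (a + b).
    by move=> [y ->] [z ->]; exists (y + z); rewrite mulmxDl.
  have P0 : P 0 by exists 0; rewrite mul0mx.
  apply: (sgen P) Nv; first by split=> // c a [y ->]; exists (c *: y); rewrite scalemxAl.
  move=> x xs; rewrite [x]hT big_seq; elim/big_rec: _ => // t y tT hy; apply: PD => //.
  have tS : (t, x) \in S by apply/allpairsPdep; exists x, t.
  have lt : (index (t, x) S < size S)%N by rewrite index_mem.
  exists (delta_mx 0 (Ordinal lt)); rewrite mul_delta_rV rowK.
  by rewrite /f /w /= nth_index.
Qed.

Definition graded_cover p (e : 'I_p -> int) (L N : 'rV[R]_p -> Prop)
    q (f : 'I_q -> int) (g : 'M[R]_(q, p)) :=
  [/\ graded_mx f e g, forall k, L (row k g) &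
      forall v, L v -> exists y, N (v - y *m g)].

Lemma hcomp0E (x : R) : hcomp 0 x = (x@_0%MM)%:MP.
Proof.
have h0 := homogeneous_hcomp 0 x.
apply/mpolyP => a; rewrite mcoeffC; have [->|a0] := eqVneq a 0%MM; last first.
  by rewrite mulr0; apply: (dhomog_nemf_coeff h0); rewrite /= mdeg_eq0.
rewrite mulr1.
have -> : x@_0%MM = \sum_(i < msize x) (hcomp (i : nat) x)@_0%MM.
  by rewrite -raddf_sum -hcomp_partition.
case: (msize x) (msize_poly_eq0 x) => [|k] x0.
  have -> : x = 0 by apply/eqP; rewrite -x0.
  by rewrite big_ord0 hcomp0 mcoeff0.
rewrite big_ord_recl big1 ?addr0 // => i _.
exact: (homogeneous_coef0 (homogeneous_hcomp _ _)).
Qed.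

(** A relation in which generator [k] has an invertible coefficient makes this generator redundant:
    a multiple of the relation cancels coordinate [k] without changing the image modulo [N]. *)
Lemma cover_drop p (e : 'I_p -> int) (L N : 'rV[R]_p -> Prop)
    q (f : 'I_q.+1 -> int) (g : 'M[R]_(q.+1, p)) k y :
  graded_submod e N -> graded_cover e L N f g -> N (y *m g) -> (y 0 k)@_0%MM != 0 ->
  graded_cover e L N (f \o lift k) (row' k g).
Proof.
move=> hN [hg gL gen] Ny yk.
(* In degree [f k] the entry [k] of the relation is exactly the nonzero scalar [c]. *)
pose z := rcomp f (f k) y; pose c := (y 0 k)@_0%MM.
have zk : z 0 k = c%:MP by rewrite mxE subrr hcomp0E.
have Nz : N (z *m g) by rewrite -(rcomp_mul _ _ hg); apply: (gsub_comp hN).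
split=> [i j|i|v Lv].
- by rewrite mxE; apply: hg.
- have -> : row i (row' k g) = row (lift k i) g by apply/rowP => j; rewrite !mxE.
  exact: gL.
have [x hx] := gen v Lv; pose w := x - (x 0 k * c^-1%:MP) *: z.
have wk : w 0 k = 0.
  rewrite mxE [X in _ + X]mxE [X in _ - X]mxE zk -mulrA -mpolyCM mulVf //.
  by rewrite mpolyC1 mulr1 subrr.
exists (col' k w); have -> : col' k w *m row' k g = w *m g.
  apply/rowP => j; rewrite !mxE (bigD1_ord k) //= wk mul0r add0r.
  by apply: eq_bigr => i _; rewrite !mxE.
have -> : v - w *m g = v - x *m g + (x 0 k * c^-1%:MP) *: (z *m g).
  by rewrite mulmxBl -scalemxAl opprB addrA addrAC.
by apply: (gsubD hN) => //; apply: (gsubZ hN).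
Qed.

(** A cover of least rank works, since [cover_drop] would otherwise lower its rank. *)
Lemma minimal_cover p (e : 'I_p -> int) (L N : 'rV[R]_p -> Prop) :
  graded_submod e L -> graded_submod e N ->
  exists q (f : 'I_q -> int) (g : 'M[R]_(q, p)), graded_cover e L N f g /\
    forall y, N (y *m g) -> forall k, (y 0 k)@_0%MM = 0.
Proof.
move=> hL hN; have [q0 [f0 [g0 [hg0 g0L gen0]]]] := graded_fg hL.
pose C q := `[< exists f (g : 'M[R]_(q, p)), graded_cover e L N f g >].
have ex : exists q, C q.
  exists q0; apply/asboolP; exists f0, g0; split=> // v /gen0 [y ->].
  by exists y; rewrite subrr; apply: gsub0 hN.
case: (ex_minnP ex) => q /asboolP [f [g hg]] qmin; exists q, f, g; split=> // y Ny k.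
apply/eqP; apply: contraT => yk.
case: q f g hg qmin y Ny k yk => [f g _ _ y _ []//|q f g hg qmin y Ny k yk].
have /qmin : C q by apply/asboolP; do 2!eexists; apply: cover_drop hg Ny yk.
by rewrite ltnn.
Qed.

(** State of the construction of a resolution: a free module with the submodule that the next map
    must have as image. By [st_min] this submodule lies in (x_1, ..., x_m) times the free module, so
    the next map will be minimal. *)
Record syz_stage := SyzStage {
  st_rank : nat;
  st_deg : 'I_st_rank -> int;
  st_mod : 'rV[R]_st_rank -> Prop;
  st_graded : graded_submod st_deg st_mod;
  st_min : forall y, st_mod y -> forall k, (y 0 k)@_0%MM = 0
}.

Record stage_cover (S : syz_stage) := StageCover {
  sc_rank : nat;
  sc_deg : 'I_sc_rank -> int;
  sc_map : 'M[R]_(sc_rank, st_rank S);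
  sc_graded : graded_mx sc_deg (@st_deg S) sc_map;
  sc_image : forall v, st_mod v <-> exists w, v = w *m sc_map;
  sc_min : forall y : 'rV[R]_sc_rank, y *m sc_map = 0 -> forall k, (y 0 k)@_0%MM = 0
}.

Lemma stage_cover_exists S : inhabited (stage_cover S).
Proof.
have [q [f [g [[hg gL gen] gmin]]]] :=
  minimal_cover (st_graded S) (graded_zero (@st_deg S)).
constructor; apply: (@StageCover S q f g) => // v; split=> [/gen [y hy]|[w ->]].
  by exists y; apply/eqP; rewrite -subr_eq0; apply/eqP.
exact: (gsub_mulmx (st_graded S) w gL).
Qed.

(** Choice turns the mere existence of a cover into data, so that the stages can be iterated. *)
Definition choose_cover S : stage_cover S :=
  projT1 (cid (let: inhabits c := stage_cover_exists S in
               ex_intro (fun _ : stage_cover S => True) c Logic.I)).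

Definition next_stage S : syz_stage :=
  let c := choose_cover S in
  @SyzStage (sc_rank c) (@sc_deg _ c) (fun y => y *m sc_map c = 0)
    (graded_pre (@sc_graded _ c) (graded_zero _)) (@sc_min _ c).

Lemma minimal_resolution_exists (I : R -> Prop) : graded_ideal I ->
  exists F : free_chain K m, minimal_graded_free_resolution I F.
Proof.
move=> hI; have hN := graded_row_ideal 0 hI.
have [q [f [g [[hg _ gen] gmin]]]] := minimal_cover (graded_full deg0) hN.
pose S0 := @SyzStage q f _ (graded_pre hg hN) gmin.
pose S i := iter i next_stage S0.
exists (@FreeChain K m (fun i => st_rank (S i)) (fun i => @st_deg (S i))
   (fun i => sc_map (choose_cover (S i))) g); split=> /=.
- split=> [k|i]; last exact: sc_graded.
  by have := hg k 0; rewrite subr0.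
- move=> r; have [y hy] := gen r%:M Logic.I; exists y.
  by move: hy; rewrite /row_ideal !mxE eqxx mulr1n.
- by move=> v; apply: (sc_image (choose_cover S0)).
- by move=> i v; apply: (sc_image (choose_cover (S i.+1))).
- move=> i k l; have : st_mod (row k (sc_map (choose_cover (S i)))).
    by apply/sc_image; exists (delta_mx 0 k); rewrite -rowE.
  by move/st_min => /(_ l); rewrite mxE.
Qed.
End Existence.

(** * Powers of an ideal generated by a d-sequence *)

Section IdealOps.
Variable A : comNzRingType.

Lemma gen_ideal_ideal n (P : pred 'I_n) (u : 'I_n -> A) : is_ideal (gen_ideal P u).
Proof.
split=> [|x y [c ->] [c' ->]|b x [c ->]].
- by exists (fun=> 0); rewrite big1 // => j _; rewrite mul0r.
- by exists (fun j => c j + c' j); rewrite -big_split; apply: eq_bigr => j _; rewrite mulrDl.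
- by exists (fun j => b * c j); rewrite mulr_sumr; apply: eq_bigr => j _; rewrite mulrA.
Qed.

Lemma gen_ideal_gen n (P : pred 'I_n) (u : 'I_n -> A) j : P j -> gen_ideal P u (u j).
Proof.
move=> Pj; exists (fun k => (k == j)%:R); rewrite (bigD1 j) //= eqxx mul1r.
by rewrite big1 ?addr0 // => k /andP [_ /negbTE ->]; rewrite mul0r.
Qed.

Lemma gen_ideal_min n (P : pred 'I_n) (u : 'I_n -> A) (I : A -> Prop) x :
  is_ideal I -> (forall j, P j -> I (u j)) -> gen_ideal P u x -> I x.
Proof.
by move=> hI h [c ->]; apply: (ideal_sum hI) => j Pj; apply: (is_idealMl hI); apply: h.
Qed.

Lemma ideal_mul_gen (I J : A -> Prop) a b : I a -> J b -> ideal_mul I J (a * b).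
Proof.
by move=> Ia Jb; exists 1%N, (fun=> a), (fun=> b); split=> //; rewrite big_ord1.
Qed.

Lemma ideal_mul_min (I J H : A -> Prop) x : is_ideal H ->
  (forall a b, I a -> J b -> H (a * b)) -> ideal_mul I J x -> H x.
Proof.
by move=> hH h [k [a [b [Ia Jb ->]]]]; apply: (ideal_sum hH) => l _; apply: h.
Qed.

Lemma ideal_mul_ideal (I J : A -> Prop) : is_ideal I -> is_ideal (ideal_mul I J).
Proof.
move=> hI; split=> [|x y [k [a [b [Ia Jb ->]]]] [l [a' [b' [Ia' Jb' ->]]]]|
                    c x [k [a [b [Ia Jb ->]]]]].
- by exists 0%N, (fun=> 0), (fun=> 0); split=> [[]//|[]//|]; rewrite big_ord0.
- pose cat (f : 'I_k -> A) (g : 'I_l -> A) i :=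
    match split i with inl j => f j | inr j => g j end.
  exists (k + l)%N, (cat a a'), (cat b b'); split.
  + by move=> i; rewrite /cat; case: split.
  + by move=> i; rewrite /cat; case: split.
  + rewrite big_split_ord /cat; congr (_ + _); apply: eq_bigr => i _.
      by rewrite (unsplitK (inl i)).
    by rewrite (unsplitK (inr i)).
- exists k, (fun i => c * a i), b; split=> // [i|]; first exact: is_idealMl.
  by rewrite mulr_sumr; apply: eq_bigr => i _; rewrite mulrA.
Qed.

Lemma ideal_mulC (I J : A -> Prop) x : is_ideal J -> ideal_mul I J x -> ideal_mul J I x.
Proof.
move=> hJ; apply: ideal_mul_min; first exact: ideal_mul_ideal.
by move=> a b Ia Jb; rewrite mulrC; apply: ideal_mul_gen.
Qed.

Lemma ideal_pow_ideal (I : A -> Prop) s : is_ideal (ideal_pow I s).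
Proof. by elim: s => [|s IH]; [split | apply: ideal_mul_ideal]. Qed.

Lemma ideal_pow_sub (I : A -> Prop) s x : is_ideal I -> ideal_pow I s.+1 x -> I x.
Proof.
by move=> hI; apply: (ideal_mul_min hI) => a b _ Ib; apply: (is_idealMl hI).
Qed.

Lemma ideal_pow1 (I : A -> Prop) x : is_ideal I -> ideal_pow I 1 x <-> I x.
Proof.
move=> hI; split; first exact: ideal_pow_sub.
by move=> Ix; rewrite -[x]mul1r; apply: ideal_mul_gen.
Qed.

Lemma ideal_pow_exp (I : A -> Prop) s x : I x -> ideal_pow I s (x ^+ s).
Proof.
by move=> Ix; elim: s => // s IH; rewrite exprSr; apply: ideal_mul_gen.
Qed.

Definition sum_ideal (I J : A -> Prop) : A -> Prop :=
  fun x => exists y, J y /\ I (x - y).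

Lemma prefix_idealS n (u : 'I_n -> A) (i : 'I_n) x :
  prefix_ideal i.+1 u x <-> add_gen (prefix_ideal i u) (u i) x.
Proof.
have hI := gen_ideal_ideal [pred j : 'I_n | (j < i)%N] u.
have hJ := gen_ideal_ideal [pred j : 'I_n | (j < i.+1)%N] u.
split.
  apply: gen_ideal_min; first exact: add_gen_ideal.
  move=> j /=; rewrite ltnS leq_eqVlt => /orP [/eqP ji|ji].
    by exists 1; rewrite mul1r (val_inj ji) subrr; apply: is_ideal0.
  by apply: add_gen_sub; apply: gen_ideal_gen.
move=> [c hc]; rewrite -(subrK (c * u i) x); apply: (is_idealD hJ).
  by apply: gen_ideal_min hc => // j /= ji; apply: gen_ideal_gen; rewrite /= ltnS ltnW.
by apply: (is_idealMl hJ); apply: gen_ideal_gen => /=.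
Qed.

Lemma prefix_ideal_full n (u : 'I_n -> A) x : prefix_ideal n u x <-> gen_ideal predT u x.
Proof.
by split=> -[c ->]; exists c; apply: eq_bigl => j /=; rewrite ltn_ord.
Qed.

Lemma prefix_ideal0 n (u : 'I_n -> A) x : prefix_ideal 0 u x <-> x = 0.
Proof.
split=> [[c ->]|->]; first by rewrite big_pred0.
exact: is_ideal0 (gen_ideal_ideal _ _).
Qed.

(** * Intersections and colons of prefix ideals with powers of [U] *)

Section AlmostRegular.
Variables (n : nat) (u : 'I_n.+1 -> A).
Hypothesis u_reg : forall i : 'I_n.+1, (i < n)%N ->
  forall r, prefix_ideal i u (r * u i) -> prefix_ideal i u r.
Hypothesis u_last : forall r, prefix_ideal n u (r * (u ord_max * u ord_max)) ->
  prefix_ideal n u (r * u ord_max).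

Let U := gen_ideal predT u.
Let J i := prefix_ideal i u.
Let hU : is_ideal U := gen_ideal_ideal _ _.
Let hJ i : is_ideal (J i) := gen_ideal_ideal _ _.
Let hUs s : is_ideal (ideal_pow U s) := ideal_pow_ideal _ _.

Let JS (i : 'I_n.+1) x : J i.+1 x <-> add_gen (J i) (u i) x.
Proof. exact: prefix_idealS. Qed.

Let Uu i : U (u i).
Proof. exact: gen_ideal_gen. Qed.

Let JU i x : J i x -> U x.
Proof. by apply: gen_ideal_min => // j _; apply: Uu. Qed.

(** For [i < n] this is regularity. For the last index, write x = c u modulo [J n], with u the last
    element: then c u^2 lies in [J n], hence so does c u by [u_last]. *)
Let colon_cap (i : 'I_n.+1) x : J i (x * u i) -> U x -> J i x.
Proof.
have [i_n|] := boolP (i < n)%N; first by move=> h _; apply: u_reg.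
rewrite -leqNgt => n_i; have -> : i = ord_max.
  by apply/val_inj/eqP; rewrite eqn_leq n_i -ltnS ltn_ord.
move=> h /prefix_ideal_full /(JS ord_max) [c hc].
have : J n (c * u ord_max).
  apply: u_last.
  have -> : c * (u ord_max * u ord_max) =
      x * u ord_max - (x - c * u ord_max) * u ord_max by ring.
  by apply: (is_idealB (hJ n)); [exact: h | apply: (is_idealMr (hJ n))].
by move=> /(is_idealD (hJ n) hc); rewrite subrK.
Qed.

(** Induction on [s] and, inside, downwards on [i] from J_(n+1) = U. The bound for [i + 1] gives w =
    a + b u_i with a in J_i U^(s+1) and b in U^(s+1). Then b u_i lies in J_i, so b does by
    [colon_cap], and the induction on [s] puts b in J_i U^s. *)
Lemma prefix_cap_pow s i w : (i <= n.+1)%N ->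
  J i w -> ideal_pow U s.+1 w -> ideal_mul (J i) (ideal_pow U s) w.
Proof.
elim: s i w => [|s IHs] i w.
  by move=> _ Jw _; rewrite -[w]mulr1; apply: ideal_mul_gen.
(* The downward induction on [i] runs over [k = n.+1 - i]. *)
move=> i_n; rewrite -(subKn i_n); move: (n.+1 - i)%N (leq_subr i n.+1) => k.
elim: k w {i i_n} => [|k IHk] w k_n.
  rewrite subn0 => _ /(ideal_mulC hU); apply: ideal_mul_min.
    exact: ideal_mul_ideal.
  by move=> a b Ua Ub; apply: ideal_mul_gen => //; apply/prefix_ideal_full.
have lt_i : (n.+1 - k.+1 < n.+1)%N by rewrite ltn_subrL.
have := IHk w (ltnW k_n); rewrite -(subnSK k_n).
pose i := Ordinal lt_i; rewrite -[(n.+1 - k.+1)%N]/(nat_of_ord i).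
move=> IH Jw Uw; have hM := ideal_mul_ideal (ideal_pow U s.+1) (hJ i).
have JwS : J i.+1 w by apply/JS; apply: add_gen_sub.
pose H x := exists a b,
  [/\ ideal_mul (J i) (ideal_pow U s.+1) a, ideal_pow U s.+1 b & x = a + b * u i].
have [a [b [Ma Ub e]]] : H w.
  apply: ideal_mul_min (IH JwS Uw) => [|x y /JS [c hc] Uy].
    split=> [|x y [a [b [Ma Ub ->]]] [a' [b' [Ma' Ub' ->]]]|c x [a [b [Ma Ub ->]]]].
    - exists 0, 0; rewrite mul0r addr0; split=> //; first exact: is_ideal0.
      exact: is_ideal0 (hUs _).
    - exists (a + a'), (b + b'); split; [exact: is_idealD | exact: (is_idealD (hUs _)) |].
      by rewrite mulrDl addrACA.
    - exists (c * a), (c * b); split; [exact: is_idealMl | exact: (is_idealMl (hUs _)) |].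
      by rewrite mulrDr mulrA.
  exists ((x - c * u i) * y), (c * y); split; first exact: ideal_mul_gen.
    exact: (is_idealMl (hUs _)).
  by rewrite mulrBl mulrAC subrK.
have Ja : J i a.
  by apply: (ideal_mul_min (hJ i)) Ma => x y Jx _; apply: (is_idealMr (hJ i)).
have Jb : J i b.
  apply: colon_cap; last exact: ideal_pow_sub Ub.
  by have := is_idealB (hJ i) Jw Ja; rewrite e addrC addKr.
rewrite e; apply: (is_idealD hM) => //.
apply: (@ideal_mul_min _ _ (colon (ideal_mul (J i) (ideal_pow U s.+1)) (u i)) _ _ _
  (IHs _ _ (ltnW lt_i) Jb Ub)); first exact: (colon_ideal hM).
by move=> x y Jx Uy; rewrite /colon -mulrA; apply: ideal_mul_gen => //; apply: ideal_mul_gen.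
Qed.

(** If x u_i = w modulo J_i with w in U^(s+1), then w lies in J_(i+1), hence in J_(i+1) U^s, so w =
    y u_i modulo J_i with y in U^s. Regularity of u_i modulo J_i then gives x - y in J_i. *)
Lemma colon_sum_pow (i : 'I_n.+1) s x : (i < n)%N ->
  colon (sum_ideal (J i) (ideal_pow U s.+1)) (u i) x <->
  sum_ideal (J i) (ideal_pow U s) x.
Proof.
move=> i_n; split=> [[w [Uw Jxw]]|[y [Uy Jxy]]]; last first.
  exists (y * u i); split; first exact: ideal_mul_gen.
  by rewrite -mulrBl; apply: (is_idealMr (hJ i)).
have JwS : J i.+1 w.
  apply/JS; exists x; rewrite -opprB; exact: (is_idealN (hJ i)).
pose H z := exists y, ideal_pow U s y /\ J i (z - y * u i).
have [y [Uy Jwy]] : H w.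
  apply: ideal_mul_min (prefix_cap_pow (ltn_ord i) JwS Uw).
    split=> [|a b [y [Uy Jy]] [z [Uz Jz]]|c a [y [Uy Jy]]].
    - exists 0; rewrite mul0r subr0; split; first exact: is_ideal0 (hUs _).
      exact: is_ideal0.
    - exists (y + z); rewrite mulrDl opprD addrACA; split; first exact: (is_idealD (hUs _)).
      exact: (is_idealD (hJ i)).
    - exists (c * y); rewrite -mulrA -mulrBr; split; first exact: (is_idealMl (hUs _)).
      exact: (is_idealMl (hJ i)).
  move=> a b /JS [c hc] Ub; exists (c * b); split; first exact: (is_idealMl (hUs _)).
  by rewrite mulrAC -mulrBl; apply: (is_idealMr (hJ i)).
exists y; split=> //; apply: u_reg => //.
by rewrite mulrBl -(subrK w (x * u i)) -addrA; apply: (is_idealD (hJ i)).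
Qed.

Lemma add_gen_sum_pow (i : 'I_n.+1) s x :
  add_gen (sum_ideal (J i) (ideal_pow U s)) (u i) x <->
  sum_ideal (J i.+1) (ideal_pow U s) x.
Proof.
split=> [[c [y [Uy Jy]]]|[y [Uy /JS [c Jc]]]].
  by exists y; split=> //; apply/JS; exists c; rewrite addrAC.
by exists c, y; split=> //; rewrite addrAC.
Qed.

Lemma sum_pow_prefix0 s x : sum_ideal (J 0) (ideal_pow U s) x <-> ideal_pow U s x.
Proof.
split=> [[y [Uy /prefix_ideal0 /eqP]]|Ux]; first by rewrite subr_eq0 => /eqP ->.
by exists x; split=> //; rewrite subrr; apply: is_ideal0.
Qed.

Lemma sum_pow1 i x : sum_ideal (J i) (ideal_pow U 1) x <-> U x.
Proof.
split=> [[y [/(ideal_pow1 _ hU) Uy /JU Uxy]]|Ux].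
  by rewrite -(subrK y x); apply: (is_idealD hU).
exists x; split; first by apply/ideal_pow1.
by rewrite subrr; apply: is_ideal0.
Qed.

(** Modulo [J n] the ideal [U] is generated by its last generator alone. *)
Lemma sum_pow_last s x :
  sum_ideal (J n) (ideal_pow U s) x <-> add_gen (J n) (u ord_max ^+ s) x.
Proof.
split; last first.
  move=> [c Jc]; exists (c * u ord_max ^+ s); split=> //.
  by apply: (is_idealMl (hUs _)); apply: ideal_pow_exp.
have sub y : ideal_pow U s y -> add_gen (J n) (u ord_max ^+ s) y.
  elim: s y => [|s IH] y.
    by move=> _; exists y; rewrite mulr1 subrr; apply: is_ideal0.
  apply: ideal_mul_min; first exact: add_gen_ideal.
  move=> a b /IH [c Jc] /prefix_ideal_full /(JS ord_max) [c' Jc'].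
  exists (c * c'); rewrite exprSr.
  have -> : a * b - c * c' * (u ord_max ^+ s * u ord_max) =
      (a - c * u ord_max ^+ s) * b + c * u ord_max ^+ s * (b - c' * u ord_max) by ring.
  by apply: (is_idealD (hJ n)); [apply: (is_idealMr (hJ n)) | apply: (is_idealMl (hJ n))].
move=> [y [/sub Uy Jy]]; rewrite -(subrK y x).
by apply: (is_idealD (add_gen_ideal (hJ n) _)) => //; apply: add_gen_sub.
Qed.

(** Each use of [u_last] removes one factor from the power. *)
Lemma colon_last_pow s x :
  colon (J n) (u ord_max) x <-> colon (J n) (u ord_max ^+ s.+1) x.
Proof.
rewrite /colon; elim: s => [|s IH]; first by rewrite expr1.
split=> [/IH h|h]; first by rewrite exprSr mulrA; apply: (is_idealMr (hJ n)).
apply/IH; move: h; rewrite !exprSr -mulrA mulrA => /u_last.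
by rewrite -mulrA.
Qed.
End AlmostRegular.
End IdealOps.

(** * The regularity bound *)

(** Ensures that [supremum] is a true least upper bound rather than its default value. A bounded set
    of integers has a maximum, and an unbounded one has supremum [+oo]. *)
Lemma int_supremums_neq0 (A : \bar int -> Prop) (x0 : int) :
  A x0%:E -> (forall x, A x -> exists z : int, x = z%:E) ->
  exists x, classical_sets.supremums A x.
Proof.
move=> Ax0 Afin; have [[b hb]|nb] := pselect (exists b : int, forall x, A x -> (x <= b%:E)%E).
  (* The least distance [j] below the bound [b] gives the largest element. *)
  have ex : exists j, `[< A (b - j%:Z)%:E >].
    exists `|b - x0|%N; apply/asboolP.
    suff -> : b - `|b - x0|%N%:Z = x0 by [].
    by have := hb _ Ax0; rewrite lee_fin; lia.
  case: (ex_minnP ex) => j /asboolP Aj jmin.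
  exists (b - j%:Z)%:E; split=> [x Ax|y hy]; last exact: hy.
  have [z ez] := Afin _ Ax; subst x.
  have := hb _ Ax; rewrite !lee_fin => zb.
  suff /jmin : `[< A (b - `|b - z|%N%:Z)%:E >] by lia.
  by apply/asboolP; have -> : b - `|b - z|%N%:Z = z by lia.
exists +oo%E; split=> [x _|y hy]; first exact: leey.
case: y hy => [b hb| |hb]; first by case: nb; exists b.
  by rewrite lexx.
by have := hb _ Ax0.
Qed.

Section Regularity.
Variables (K : fieldType) (m : nat).
Local Notation R := {mpoly K[m]}.

Lemma reg_quotient_le (I : R -> Prop) r :
  graded_ideal I -> reg_le I r -> (reg_quotient I <= r%:E)%E.
Proof.
move=> hI hr; rewrite /reg_quotient /classical_sets.supremum.
case: ifP => _; first exact: leNye.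
case: classical_sets.xgetP => [y _ [_ y_min]|_]; last exact: leNye.
apply: y_min => _ [F [i [k [hF ->]]]].
by rewrite lee_fin lerBlDr; apply: (min_res_deg hI hF hr).
Qed.

(** One minimal resolution is enough: its shifts lie below the supremum, and its maps provide the
    covers. *)
Lemma reg_quotient_ge (I : R -> Prop) r :
  graded_ideal I -> (reg_quotient I <= r%:E)%E -> reg_le I r.
Proof.
move=> hI hr; have [F hF] := minimal_resolution_exists hI.
apply: (min_res_reg hF) => i k; rewrite -lerBlDr -lee_fin.
have hk : betti_shifts I (res_deg k - i%:Z)%:E by exists F, i, k.
apply: le_trans hr; apply: classical_sets.ge_supremum_Nmem => //.
apply: (int_supremums_neq0 hk) => _ [F' [i' [k' [_ ->]]]].
by exists (res_deg k' - i'%:Z).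
Qed.

(** * Gradedness of sums, products and powers of ideals *)

Lemma graded_gen_ideal n (P : pred 'I_n) (u : 'I_n -> R) (d : 'I_n -> nat) :
  (forall i, u i \is (d i).-homog) -> graded_ideal (gen_ideal P u).
Proof.
move=> hu; split=> [|t _ [c ->]]; first exact: gen_ideal_ideal.
exists (fun j => hcomp (t - (d j)%:Z) (c j)).
by rewrite hcomp_sum; apply: eq_bigr => j _; apply: hcompMr; apply: hu.
Qed.

Lemma graded_ideal_mul (I J : R -> Prop) :
  graded_ideal I -> graded_ideal J -> graded_ideal (ideal_mul I J).
Proof.
move=> [hI gI] [hJ gJ]; have hM := ideal_mul_ideal J hI; split=> // t x.
(* The elements with all components in the product form an ideal, so only products a b remain to be
   tested. *)
pose H y := forall s, ideal_mul I J (hcomp s y).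
move=> Mx; move: t; apply: (@ideal_mul_min _ I J H x _ _ Mx) => [|a b Ia Jb s].
  split=> [s|y z hy hz s|c y hy s].
  - by rewrite hcomp0; apply: is_ideal0.
  - by rewrite hcompD; apply: is_idealD.
  - rewrite [y](hcomp_partition y) mulr_sumr hcomp_sum.
    apply: (ideal_sum hM) => i _.
    rewrite (hcompMr _ _ (homogeneous_hcomp (i : nat) y)).
    by apply: is_idealMl.
rewrite [b](hcomp_partition b) mulr_sumr hcomp_sum.
apply: (ideal_sum hM) => i _.
rewrite (hcompMr _ _ (homogeneous_hcomp (i : nat) b)).
by apply: ideal_mul_gen; [apply: gI | apply: gJ].
Qed.

Lemma graded_ideal_pow (I : R -> Prop) s : graded_ideal I -> graded_ideal (ideal_pow I s).
Proof.
by move=> hI; elim: s => [|s IH]; [split | apply: graded_ideal_mul].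
Qed.

Lemma graded_sum_ideal (I J : R -> Prop) :
  graded_ideal I -> graded_ideal J -> graded_ideal (sum_ideal I J).
Proof.
move=> [hI gI] [hJ gJ]; split; first split.
- exists 0; rewrite subr0; split; exact: is_ideal0.
- move=> x y [a [Ja Ia]] [b [Jb Ib]]; exists (a + b).
  by rewrite opprD addrACA; split; apply: is_idealD.
- move=> c x [a [Ja Ia]]; exists (c * a).
  by rewrite -mulrBr; split; apply: is_idealMl.
move=> t x [a [Ja Ia]]; exists (hcomp t a); split; first exact: gJ.
have -> : hcomp t x - hcomp t a = hcomp t (x - a).
  by apply/eqP; rewrite subr_eq -hcompD subrK.
exact: gI.
Qed.

(** * The bound for a d-sequence *)

Section Bound.
Variables (n : nat) (u : 'I_n.+1 -> R) (d : 'I_n.+1 -> nat).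
Hypothesis u_homog : forall i, u i \is (d i).-homog.
Hypothesis u_dseq : d_sequence u.
Hypothesis u_regseq :
  regular_sequence (fun i : 'I_n => u (widen_ord (leq_pred n.+1) i)).

Let U := gen_ideal predT u.
Let J i := prefix_ideal i u.
Let dmax := (\max_(i < n.+1) d i)%N.
Let dsum := (\sum_(i < n) d (widen_ord (leq_pred n.+1) i))%N.

Let hJ i : is_ideal (J i) := gen_ideal_ideal _ _.
Let gU : graded_ideal U := graded_gen_ideal _ u_homog.
Let gJ i : graded_ideal (J i) := graded_gen_ideal _ u_homog.
Let gUs s : graded_ideal (ideal_pow U s) := graded_ideal_pow s gU.

(** The constant is nonzero because 0 lies in the ideal generated by the other elements, which [u i]
    must avoid. *)
Let u_const i : d i = 0%N -> exists2 c : K, c != 0 & u i = c%:MP.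
Proof.
move=> di; have hu : homogeneous 0 (u i) by have := u_homog i; rewrite di.
exists ((u i)@_0%MM); last by rewrite -[LHS](hcomp_id hu) hcomp0E.
apply/eqP => c0; have [/(_ i) nu _] := u_dseq; apply: nu.
rewrite -(hcomp_id hu) hcomp0E c0 mpolyC0.
exact: is_ideal0 (gen_ideal_ideal _ _).
Qed.

Let u_unit i : d i = 0%N -> exists v : R, v * u i = 1.
Proof.
move=> /u_const [c c0 ->]; exists c^-1%:MP.
by rewrite -mpolyCM mulVf // mpolyC1.
Qed.

Let prefix_widen i x : (i <= n)%N ->
  prefix_ideal i (fun i : 'I_n => u (widen_ord (leq_pred n.+1) i)) x <-> J i x.
Proof.
move=> i_n; split; apply: gen_ideal_min; try exact: gen_ideal_ideal.
  by move=> j /= ji; apply: gen_ideal_gen.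
move=> j /= ji; have jn := leq_trans ji i_n.
have -> : j = widen_ord (leq_pred n.+1) (Ordinal jn) by apply: val_inj.
exact: (@gen_ideal_gen _ _ _ (fun i : 'I_n => u (widen_ord (leq_pred n.+1) i))).
Qed.

Let u_reg (i : 'I_n.+1) : (i < n)%N ->
  forall r, prefix_ideal i u (r * u i) -> prefix_ideal i u r.
Proof.
move=> i_n r hr; have [hreg _] := u_regseq.
apply/(prefix_widen _ (ltnW i_n)); apply: (hreg (Ordinal i_n)).
apply/(prefix_widen _ (ltnW i_n)).
by have -> : widen_ord (leq_pred n.+1) (Ordinal i_n) = i by apply: val_inj.
Qed.

Let d_gt0 (i : 'I_n.+1) : (i < n)%N -> (0 < d i)%N.
Proof.
move=> i_n; rewrite lt0n; apply/eqP => /u_unit [v hv].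
have [_] := u_regseq; apply; rewrite -hv.
have -> : i = widen_ord (leq_pred n.+1) (Ordinal i_n) by apply: val_inj.
apply: (is_idealMl (gen_ideal_ideal _ _)).
exact: (@gen_ideal_gen _ _ _ (fun i : 'I_n => u (widen_ord (leq_pred n.+1) i))).
Qed.

Let u_last r : prefix_ideal n u (r * (u ord_max * u ord_max)) ->
  prefix_ideal n u (r * u ord_max).
Proof. by have [_ /(_ ord_max ord_max (leqnn _) r) []] := u_dseq. Qed.

Let prefix_deg i := (\sum_(j < n.+1 | (j < i)%N) d j)%N.

Let prefix_degS (i : 'I_n.+1) : prefix_deg i.+1 = (prefix_deg i + d i)%N.
Proof.
rewrite /prefix_deg (bigD1 i) //= addnC; congr (_ + _)%N; apply: eq_bigl => j.
by rewrite ltnS [RHS]ltn_neqAle andbC.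
Qed.

Let prefix_deg_last : prefix_deg n = dsum.
Proof.
rewrite /prefix_deg big_mkcond big_ord_recr /= ltnn addn0; apply: eq_bigr => j _.
by rewrite /= ltn_ord; congr d; apply: val_inj.
Qed.

(** Each regular element [u i] has colon [J i], and [reg_le_quot] raises the bound by [d i - 1]. *)
Let reg_prefix i : (i <= n)%N -> reg_le (J i) ((prefix_deg i)%:Z - i%:Z).
Proof.
elim: i => [_|i IH i_n].
  have -> : prefix_deg 0 = 0%N by rewrite /prefix_deg big_pred0.
  have f0 k : deg0 k <= 0 by [].
  move=> k; rewrite subr0; apply: Reg_eq (Reg_free K m k f0) => // v.
  rewrite /row_ideal; split=> [->|/prefix_ideal0 v0].
    by rewrite mxE; apply: is_ideal0.
  by apply/rowP => l; rewrite ord1 v0 mxE.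
pose i' := Ordinal (ltnW i_n : (i < n.+1)%N).
apply: (@reg_le_eq _ _ (add_gen (J i') (u i'))).
  by move=> x; exact: (iff_sym (prefix_idealS u i' x)).
(* Positive degrees keep the bound from decreasing, as the first hypothesis of [reg_le_quot]
   requires. *)
have di := d_gt0 (i_n : (i' < n)%N).
have := prefix_degS i' => /= degS.
apply: (reg_le_quot (gJ i') (u_homog i' : homogeneous (d i')%:Z (u i'))).
  by apply: reg_le_trans (IH (ltnW i_n)); rewrite degS; lia.
apply: (@reg_le_eq _ _ (J i')).
  move=> x; split; last exact: u_reg.
  by rewrite /colon; apply: (is_idealMr (hJ i')).
by apply: reg_le_trans (IH (ltnW i_n)); rewrite degS; lia.
Qed.

Let d_le i : (d i <= dmax)%N.
Proof. exact: leq_bigmax. Qed.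

Section Tau.
(** Bounds both terms of the maximum. With [n.+1] elements sigma is [dsum - n], so [tau_ge] reads
    sigma <= tau + 1. *)
Variable tau : int.
Hypothesis reg_U : reg_le U tau.
Hypothesis tau_ge : dsum%:Z - n.+1%:Z <= tau.

Let reg_last_pow s : reg_le (add_gen (J n) (u ord_max ^+ s.+1)) (dmax%:Z * s%:Z + tau).
Proof.
have UE x : U x <-> add_gen (J n) (u ord_max) x.
  apply: iff_trans (prefix_idealS u ord_max x).
  exact: (iff_sym (prefix_ideal_full u x)).
case: s => [|s].
  rewrite mulr0 add0r expr1; exact: reg_le_eq reg_U.
(* A last element of degree 0 is a unit, and the quotient is then zero. *)
have [d0|d_pos] := posnP (d ord_max).
  apply: reg_le_unit => x; have [v hv] := u_unit d0; exists (x * v ^+ s.+2).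
  by rewrite -mulrA -exprMn hv expr1n mulr1 subrr; apply: is_ideal0.
have hl : homogeneous (d ord_max)%:Z (u ord_max) := u_homog _.
have hls : homogeneous (d ord_max * s.+2)%N (u ord_max ^+ s.+2) by apply: dhomogMn.
have regJ := reg_prefix (leqnn n); rewrite prefix_deg_last in regJ.
have regc : reg_le (colon (J n) (u ord_max)) (tau + 1 - (d ord_max)%:Z).
  apply: (reg_le_colon (gJ n) hl); first by apply: reg_le_trans regJ; lia.
  by rewrite addrK; apply: reg_le_eq reg_U.
apply: (@reg_le_trans _ _ _ ((d ord_max)%:Z * s.+1%:Z + tau)).
  by rewrite lerD2r ler_wpM2r // lez_nat.
apply: (reg_le_quot (gJ n) hls).
  by apply: reg_le_trans regJ; nia.
apply: (reg_le_eq (colon_last_pow u_last s.+1)).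
(* Both bounds agree: with d the last degree, d (s + 1) + tau + 1 - d (s + 2) = tau + 1 - d. *)
by apply: reg_le_trans regc; nia.
Qed.

(** Induction on [s] and downwards on [i] from [reg_last_pow]; the colon by [u i] lowers the
    exponent by one at the cost of [d i <= dmax]. *)
Let reg_sum_pow s i : (i <= n)%N ->
  reg_le (sum_ideal (J i) (ideal_pow U s.+1)) (dmax%:Z * s%:Z + tau).
Proof.
elim: s i => [|s IHs] i i_n.
  apply: (@reg_le_eq _ _ U); first by move=> x; exact: (iff_sym (sum_pow1 u i x)).
  by rewrite mulr0 add0r.
rewrite -(subKn i_n); move: (n - i)%N (leq_subr i n) => k.
elim: k {i i_n} => [|k IHk] k_n.
  rewrite subn0; apply: reg_le_eq (reg_last_pow s.+1) => x.
  exact: (iff_sym (sum_pow_last u s.+2 x)).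
have lt_i : (n - k.+1 < n)%N by rewrite ltn_subrL (leq_trans _ k_n).
have := IHk (ltnW k_n); rewrite -(subnSK k_n).
pose i := Ordinal (ltnW lt_i : (n - k.+1 < n.+1)%N).
rewrite -[(n - k.+1)%N]/(nat_of_ord i) => IH.
apply: (reg_le_ext (graded_sum_ideal (gJ i) (gUs _)) (u_homog i : homogeneous (d i)%:Z (u i))).
  apply: (@reg_le_eq _ _ (sum_ideal (J i) (ideal_pow U s.+1))).
    by move=> x; exact: (iff_sym (colon_sum_pow (i := i) u_reg u_last s.+1 x lt_i)).
  apply: reg_le_trans (IHs _ (ltnW lt_i)).
  by have := d_le i; nia.
by apply: reg_le_eq IH => x; exact: (iff_sym (add_gen_sum_pow u i s.+2 x)).
Qed.

Lemma reg_le_pow s : reg_le (ideal_pow U s.+1) (dmax%:Z * s%:Z + tau).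
Proof.
by apply: reg_le_eq (reg_sum_pow s (leq0n n)) => x; apply: sum_pow_prefix0.
Qed.
End Tau.
End Bound.
End Regularity.

Theorem corollary2p11 (K : fieldType) (m n : nat)
    (u : 'I_n -> {mpoly K[m]}) (d : 'I_n -> nat) (s : nat) :
  (0 < n)%N ->
  (forall i, u i \is (d i).-homog) ->
  d_sequence u ->
  regular_sequence (fun i : 'I_n.-1 => u (widen_ord (leq_pred n) i)) ->
  (1 <= s)%N ->
  let U := gen_ideal predT u in
  let dmax := (\max_(i < n) d i)%N in
  let dsum := (\sum_(i < n.-1) d (widen_ord (leq_pred n) i))%N in
  (reg_quotient (ideal_pow U s) <=
     (dmax%:Z * (s%:Z - 1))%:E
     + Order.max (reg_quotient U) (dsum%:Z - n%:Z)%:E)%E.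
Proof.
case: n u d => // n u d _ hu hd hreg; case: s => // s _; cbv zeta.
set U := gen_ideal predT u.
have gU : graded_ideal U := graded_gen_ideal _ hu.
have -> : s.+1%:Z - 1 = s%:Z by rewrite -addn1 PoszD addrK.
set b := (_%:Z - n.+1%:Z).
have : (reg_quotient U <= Order.max (reg_quotient U) b%:E)%E by rewrite le_max lexx.
have : (b%:E <= Order.max (reg_quotient U) b%:E)%E by rewrite le_max lexx orbT.
(* The maximum is at least the integer [b], which excludes [-oo]; for [+oo] the bound is trivial,
   and a finite value serves as [tau]. *)
case: (Order.max _ _) => [tau|_ _|//]; last by rewrite addey ?leey.
rewrite lee_fin => b_tau U_tau; rewrite -EFinD.
apply: reg_quotient_le; first exact: graded_ideal_pow.
exact: (reg_le_pow hu hd hreg (reg_quotient_ge gU U_tau) b_tau).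
Qed.
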